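(* Let $p$ be a prime with $p\equiv 2\pmod 3$, let $m_p=(p+1)/3$, and let $n\in\mathbb{N}$. If $A\subset\mathbb{F}_p^n$ is sum-free and $|A|\ge (m_p-1/2+1/p)p^{n-1}$, then $A$ is normal, i.e. there exist a subspace $V<\mathbb{F}_p^n$ of co-dimension $1$ and $w\in\mathbb{F}_p^n\setminus V$ with $A\subset\{m_pw,(m_p+1)w,\ldots,(2m_p-1)w\}+V$.
   Context: A set $A\subset\mathbb{F}_p^n$ is sum-free if there are no $a,b,c\in A$ with $a+b=c$. *)

(* Defs.v *)
From mathcomp Require Import all_boot all_order all_algebra.

Set Implicit Arguments.
Unset Strict Implicit.
Unset Printing Implicit Defensive.

Import Order.TTheory GRing.Theory Num.Theory.
Local Open Scope ring_scope.

Definition sum_free (G : finZmodType) (A : {set G}) : Prop :=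
  forall a b c, a \in A -> b \in A -> c \in A -> a + b <> c.

(* The division is exact when p = 2 %[mod 3]. *)
Definition mid (p : nat) : nat := (p.+1 %/ 3)%N.

Definition codim (K : fieldType) (T : vectType K) (V : {vspace T}) : nat :=
  (\dim {:T} - \dim V)%N.

Definition normal_set (p n : nat) (A : {set 'rV['F_p]_n}) : Prop :=
  exists (V : {vspace 'rV['F_p]_n}) (w : 'rV['F_p]_n),
    [/\ codim V = 1%N, w \notin V
      & forall a, a \in A ->
          exists (k : nat) (v : 'rV['F_p]_n),
            [/\ (mid p <= k <= 2 * mid p - 1)%N, v \in V & a = w *+ k + v]].

(* Main.v *)
(**
Let [p = 3m - 1] and let [I] be the middle interval [m, ..., 2m-1] of F_p. By
induction on the dimension there is a linear functional mapping [A] into [I].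
In dimension one this is Vosper's theorem: [|A + A| <= 2|A| - 1], so [A] is a
progression, and a sum-free progression of length [m] is a dilate of [I].

In higher dimension, averaging yields a hyperplane [ker psi] whose section of
[A] is again large, hence mapped into [I] by a functional [phi]. Let [al k x] be
the number of elements of [A] with [psi = k] and [phi = x], at most
[w = p^(n-2)], and let [d_k = m w - \sum_x al k x] be the deficit of the line [k].
Sum-freeness gives [al k x + al l y <= w] as soon as [al (k+l) (x+y) > 0], and
Cauchy-Davenport on superlevel sets shows that a line of small deficit is
supported on a translate [s_k + I], and that [S_(k+l)] lies in [s_k + s_l + I]
whenever [d_k + d_l < w]. The hypothesis on [|A|] says [2 \sum_k d_k <= (p - 2) w];
a double count over thresholds produces sets [G] (tiny deficits) and [E] (deficits
summing to less than [w] with those in [G]) with [|G| + |E| >= p + 2]. If the points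
[(k, s_k)], [k] in [G], were not collinear, the sumset of the graphs of [s] over [G]
and over [E] would have at least [p + |G| - 1] points, while each further value above
a given abscissa costs deficit. Collinearity then propagates to [E], and from
[G + E = F_p] to all lines: [phi - c psi] is the required functional.
*)
Require Import Defs.
From mathcomp Require Import all_boot all_order all_algebra.
From mathcomp Require Import zify ring lra.
Import Order.TTheory GRing.Theory Num.Theory.
Set Implicit Arguments.
Unset Strict Implicit.
Unset Printing Implicit Defensive.
Local Open Scope ring_scope.

(** * Sumsets and progressions in a prime field *)

Section Sumsets.
Variable F : finFieldType.
Implicit Types (A B C D X Y : {set F}) (a b d e x y : F).

Definition sumset A B : {set F} := [set x + y | x in A, y in B].
Definition shift e A : {set F} := [set x | x - e \in A].
Arguments shift e%_ring_scope A.

Lemma card_setT_F A : A = setT -> #|A| = #|F|.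
Proof. by move->; exact: cardsT. Qed.

Lemma card_setC_F A : (#|A| + #|~: A| = #|F|)%N.
Proof. exact: cardsC. Qed.

Lemma card_le_F A : (#|A| <= #|F|)%N.
Proof. exact: max_card. Qed.

Lemma mem_sumset A B x y : x \in A -> y \in B -> x + y \in sumset A B.
Proof. by move=> xA yB; apply/imset2P; exists x y. Qed.

Lemma sumsetC A B : sumset A B = sumset B A.
Proof.
by apply/setP=> z; apply/imset2P/imset2P=> -[x y xA yB ->]; exists y x; rewrite // addrC.
Qed.

Lemma sumsetA A B C : sumset A (sumset B C) = sumset (sumset A B) C.
Proof.
apply/setP=> z; apply/imset2P/imset2P.
  move=> [x _ xA /imset2P[y t yB tC ->] ->].
  by exists (x + y) t; rewrite ?mem_sumset // addrA.
move=> [_ t /imset2P[x y xA yB ->] tC ->].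
by exists x (y + t); rewrite ?mem_sumset // addrA.
Qed.

Lemma sumsetS A B C D : A \subset C -> B \subset D -> sumset A B \subset sumset C D.
Proof.
move=> /subsetP AC /subsetP BD; apply/subsetP=> _ /imset2P[x y xA yB ->].
by rewrite mem_sumset ?AC ?BD.
Qed.

Lemma card_shift e A : #|shift e A| = #|A|.
Proof.
rewrite -(card_imset A (addIr e)); apply: eq_card => x; rewrite inE.
apply/idP/imsetP=> [xA|[y yA ->]]; last by rewrite addrK.
by exists (x - e); rewrite ?subrK.
Qed.

Lemma card_le_sumset A B b : b \in B -> (#|A| <= #|sumset A B|)%N.
Proof.
move=> bB; rewrite -(card_shift b); apply/subset_leq_card/subsetP=> x; rewrite inE => xA.
by rewrite -(subrK b x) mem_sumset.
Qed.

Lemma sumsetN0 A B : A != set0 -> B != set0 -> sumset A B != set0.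
Proof.
move=> /set0Pn[a aA] /set0Pn[b bB]; apply/set0Pn.
by exists (a + b); rewrite mem_sumset.
Qed.

(** Dyson's e-transform replaces the pair by [A :|: (B + e)] and [B :&: (A - e)]. Translation by [e]
    carries the second set onto [A :&: (B + e)], so the sizes keep their sum. *)
Lemma dyson_card e A B : (#|A :|: shift e B| + #|B :&: shift (- e) A| = #|A| + #|B|)%N.
Proof.
have -> : #|B :&: shift (- e) A| = #|A :&: shift e B|.
  rewrite -(card_shift e); apply: eq_card => x.
  by rewrite !inE opprK subrK andbC.
by rewrite cardsUI card_shift.
Qed.

Lemma dyson_sub e A B :
  sumset (A :|: shift e B) (B :&: shift (- e) A) \subset sumset A B.
Proof.
apply/subsetP=> _ /imset2P[x y + + ->]; rewrite !inE opprK => xAB /andP[yB yA].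
case/orP: xAB => [xA|xB]; first exact: mem_sumset.
by rewrite -(subrK e x) -addrA addrC [e + y]addrC mem_sumset.
Qed.

(** This expresses that [F] is a prime field; every nonzero [d] then generates its additive
    group. *)
Hypothesis natF : forall x : F, exists n, x = n%:R.

Lemma genF d x : d != 0 -> exists n, x = d *+ n.
Proof.
move=> d0; have [n en] := natF (x / d); exists n.
by rewrite -mulr_natl -en divfK.
Qed.

Lemma closedT d A : d != 0 -> A != set0 -> {in A, forall x, x + d \in A} -> A = setT.
Proof.
move=> d0 /set0Pn[a aA] clA; apply/setP=> x; rewrite inE.
have [n en] := genF (x - a) d0.
have {x en} -> : x = a + d *+ n by rewrite -en addrC subrK.
by elim: n => [|n IHn]; rewrite ?addr0 // mulrSr addrA clA.
Qed.

(** Induction on [#|B|]. As [A] is not stable under translation by [b2 - b1], some e-transform keeps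
    [b1] in [B] and loses [b2], while the sumset does not grow. *)
Lemma cauchy_davenport A B : A != set0 -> B != set0 -> sumset A B != setT ->
  (#|A| + #|B| <= #|sumset A B|.+1)%N.
Proof.
have [k] := ubnP #|B|; elim: k A B => // k IHk A B leBk A0 B0 AB.
case: (leqP #|B| 1) => [B1|/card_gt1P[b1 [b2 [b1B b2B b12]]]].
  case/set0Pn: B0 => b bB; have := card_le_sumset A bB; lia.
have d0 : b2 - b1 != 0 by rewrite subr_eq0 eq_sym.
have /existsP[a /andP[aA adA]] : [exists a in A, a + (b2 - b1) \notin A].
  apply: contraR AB => /existsPn nA.
  rewrite (@closedT (b2 - b1) A d0 A0); last first.
    by move=> x xA; have := nA x; rewrite xA /= negbK.
  apply/eqP/setP=> x; rewrite inE -(subrK b1 x); apply: mem_sumset => //; exact: in_setT.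
pose e := a - b1; pose A' := A :|: shift e B; pose B' := B :&: shift (- e) A.
have b1B' : b1 \in B' by rewrite !inE b1B opprK addrC subrK.
have A'0 : A' != set0 by apply/set0Pn; exists a; rewrite inE aA.
have B'0 : B' != set0 by apply/set0Pn; exists b1.
have ltB : (#|B'| < #|B|)%N.
  apply/proper_card/properP; split; first exact: subsetIl.
  by exists b2; rewrite // !inE opprK b2B /= addrCA.
have sAB := dyson_sub e A B.
have A'B' : sumset A' B' != setT.
  by apply: contraNneq AB => eT; rewrite -subTset -eT.
have := IHk A' B' (leq_trans ltB leBk) A'0 B'0 A'B'.
by rewrite dyson_card => /leq_trans; apply; rewrite ltnS subset_leq_card.
Qed.

Lemma cauchy_davenport_setC A B C : A != set0 -> B != set0 -> C != set0 ->
  sumset A B \subset ~: C -> (#|A| + #|B| + #|C| <= #|F|.+1)%N.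
Proof.
move=> A0 B0 C0 sAB; have := card_setC_F C; have := subset_leq_card sAB.
have : sumset A B != setT.
  case/set0Pn: C0 => c cC; apply: contraTneq sAB => ->.
  by apply/subsetPn; exists c; rewrite !inE ?cC.
move/(cauchy_davenport A0 B0); lia.
Qed.

Lemma pigeonhole_sumset A B : (#|F| < #|A| + #|B|)%N -> sumset A B = setT.
Proof.
move=> ltF; apply/setP=> x; rewrite inE.
pose B' := [set y | x - y \in B].
have cB' : #|B'| = #|B|.
  rewrite -(card_imset B (@inv_inj _ (fun y => x - y) (fun y => subKr x y))).
  apply: eq_card => y; rewrite inE; apply/idP/imsetP => [yB|[z zB ->]]; last by rewrite subKr.
  by exists (x - y); rewrite ?subKr.
have [I0|/set0Pn[y]] := eqVneq (A :&: B') set0.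
  by move: ltF; rewrite -cB' -cardsUI I0 cards0 addn0 ltnNge max_card.
by rewrite !inE => /andP[yA yB]; rewrite -(subrK y x) addrC mem_sumset.
Qed.

(* [ap d A] holds for the arithmetic progressions of difference [d], as well
   as for the empty and the full set: at most one element of [A] is last. *)
Definition ends d A : {set F} := [set x in A | x + d \notin A].
Definition ap d A := (#|ends d A| <= 1)%N.

(** Each end [x] contributes exactly one new element, [x + d]. *)
Lemma ap_sum2 d A : ap d A = (#|sumset A [set 0%R; d]| <= #|A|.+1)%N.
Proof.
have -> : sumset A [set 0; d] = A :|: shift d (ends d A).
  apply/setP=> z; rewrite !inE subrK; apply/imset2P/idP.
    move=> [x y xA]; rewrite !inE => /orP[] /eqP -> ->; first by rewrite addr0 xA.
    by rewrite addrK xA; case: (_ \in A).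
  case: (boolP (z \in A)) => [zA _|_ /= /andP[zA _]].
    by exists z 0; rewrite ?inE ?eqxx ?addr0.
  by exists (z - d) d; rewrite ?inE ?eqxx ?orbT ?subrK.
rewrite cardsU card_shift.
have -> : A :&: shift d (ends d A) = set0.
  by apply/setP=> z; rewrite !inE subrK; case: (z \in A); rewrite ?andbF //.
by rewrite cards0 subn0 /ap -[#|A|.+1]addn1 leq_add2l.
Qed.

(** Under steps of length [d], a set is left as often as it is entered. *)
Lemma ap_setC d A : ap d (~: A) = ap d A.
Proof.
rewrite /ap.
have eA : #|[set x in A | x + d \in A]| = #|[set x in A | x - d \in A]|.
  rewrite -(card_shift d); apply: eq_card => x; rewrite !inE subrK andbC //.
have e1 : (#|ends d A| + #|[set x in A | (x + d)%R \in A]| = #|A|)%N.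
  rewrite addnC -(cardsID [set x | x + d \in A] A); congr (_ + _)%N; apply: eq_card => x;
    by rewrite !inE // andbC.
have e2 : (#|ends d (~: A)| + #|[set x in A | (x - d)%R \in A]| = #|A|)%N.
  rewrite -[#|ends d (~: A)|](card_shift d) addnC -(cardsID [set x | x - d \in A] A).
  congr (_ + _)%N; apply: eq_card => x; rewrite !inE ?subrK // negbK andbC //.
by congr (_ <= _)%N; move: e1 e2; rewrite eA; lia.
Qed.

(** Without its end, [A] becomes [A0] with [A0 + {0, d}] inside [A]; Cauchy-Davenport for [A0] and
    [B + {0, d}] then allows the latter at most one element more than [B]. *)
Lemma ap_critical d A B : d != 0 -> ap d A -> (1 < #|A|)%N -> B != set0 ->
  sumset A B != setT -> (#|sumset A B| < #|A| + #|B|)%N -> ap d B.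
Proof.
move=> d0 apA A1 B0 AB ltAB; rewrite ap_sum2.
pose A0 := [set x in A | x + d \in A].
have cA0 : (#|A| <= #|A0|.+1)%N.
  have <- : (#|A0| + #|ends d A| = #|A|)%N.
    rewrite -(cardsID [set x | x + d \in A] A).
    by congr (_ + _)%N; apply: eq_card => x; rewrite !inE // andbC.
  by rewrite -addn1 leq_add2l.
have A00 : A0 != set0 by rewrite -card_gt0; lia.
have sub : sumset A0 (sumset B [set 0; d]) \subset sumset A B.
  rewrite [sumset B _]sumsetC sumsetA; apply: sumsetS => //.
  apply/subsetP=> _ /imset2P[x y + + ->]; rewrite !inE => /andP[xA xdA].
  by case/orP=> /eqP ->; rewrite ?addr0.
have B20 : sumset B [set 0; d] != set0.
  by apply: sumsetN0 => //; apply/set0Pn; exists 0; rewrite !inE eqxx.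
have nT : sumset A0 (sumset B [set 0; d]) != setT.
  by apply: contraNneq AB => eT; rewrite -subTset -eT.
have := cauchy_davenport A00 B20 nT; have := subset_leq_card sub; lia.
Qed.

(** An end of the sumset can only be the sum of an end of [A] and an end of [B]. *)
Lemma ap_sumset d A B : ap d A -> ap d B -> ap d (sumset A B).
Proof.
move=> apA apB; apply/card_le1_eqP => z t; rewrite !inE.
move=> /andP[/imset2P[x y xA yB ->] nz] /andP[/imset2P[x' y' xA' yB' ->] nt].
have nA u v : u \in A -> v \in B -> u + v + d \notin sumset A B ->
    (u \in ends d A) && (v \in ends d B).
  move=> uA vB; rewrite !inE uA vB /= -negb_or; apply: contra => /orP[ud|vd].
    by rewrite addrAC mem_sumset.
  by rewrite -addrA mem_sumset.
have /andP[xl yl] := nA _ _ xA yB nz; have /andP[xl' yl'] := nA _ _ xA' yB' nt.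
by rewrite (card_le1_eqP apA _ _ xl xl') (card_le1_eqP apB _ _ yl yl').
Qed.

Definition oppset A : {set F} := [set x | - x \in A].

Lemma card_oppset A : #|oppset A| = #|A|.
Proof.
rewrite -(card_imset A (@oppr_inj F)); apply: eq_card => x; rewrite inE.
apply/idP/imsetP=> [xA|[y yA ->]]; last by rewrite opprK.
by exists (- x); rewrite ?opprK.
Qed.

Lemma ap_shift d e A : ap d (shift e A) = ap d A.
Proof.
rewrite /ap; congr (_ <= _)%N; rewrite -(card_shift e (ends d A)).
by apply: eq_card => x; rewrite !inE addrAC.
Qed.

Lemma ap_opp d A : ap d (oppset A) -> ap d A.
Proof.
move=> h; rewrite -(ap_setC d A) /ap.
rewrite -(card_shift d) -card_oppset; apply: leq_trans h.
apply/subset_leq_card/subsetP => x; rewrite !inE subrK negbK opprD.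
by move=> /andP[-> ->].
Qed.

Lemma sumset_shiftr e A B : sumset A (shift e B) = shift e (sumset A B).
Proof.
apply/setP=> z; rewrite inE; apply/imset2P/imset2P=> -[x y xA].
  by rewrite inE => yB ->; exists x (y - e); rewrite ?addrA.
move=> yB ez; exists x (y + e); rewrite ?inE ?addrK // addrA -ez subrK //.
Qed.

(* If [A + B] is a progression, so is its complement [D], and [D - B] is
   disjoint from [A]; hence [-B] is a progression, and then so is [A]. *)
Lemma ap_of_sumset d A B : d != 0 -> (1 < #|A|)%N -> (1 < #|B|)%N ->
  (#|sumset A B| < #|A| + #|B|)%N -> (#|sumset A B|.+1 < #|F|)%N ->
  ap d (sumset A B) -> ap d A /\ ap d B.
Proof.
move=> d0 A1 B1 ltAB ltF apAB.
have A0 : A != set0 by rewrite -card_gt0; lia.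
have B0 : B != set0 by rewrite -card_gt0; lia.
have nT : sumset A B != setT by apply: contraTneq ltF => ->; rewrite cardsT -leqNgt leqW.
pose D := ~: sumset A B.
have cD := card_setC_F (sumset A B); rewrite -/D in cD.
have sD : sumset D (oppset B) \subset ~: A.
  apply/subsetP=> _ /imset2P[x y xD yB ->]; rewrite inE; apply: contraL xD => xyA.
  by rewrite !inE negbK -(addrK y x) mem_sumset //; rewrite inE in yB.
have := subset_leq_card sD; have := card_setC_F A => cA lD.
have D1 : (1 < #|D|)%N by lia.
have apB : ap d B.
  apply: ap_opp; apply: (@ap_critical d D) => //; rewrite ?ap_setC ?card_oppset //.
  - by rewrite -card_gt0 card_oppset; lia.
  - by apply/eqP=> /card_setT_F eT; lia.
  - by lia.
split=> //; apply: (@ap_critical d B) => //; rewrite sumsetC //; lia.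
Qed.

(** Induction on [#|B|] through e-transforms that keep [b0]. One that shrinks [B] properly to at
    least two elements leads to a smaller pair; if there is none, counting forces [#|B| <= 2]. *)
Lemma vosper A B : (1 < #|A|)%N -> (1 < #|B|)%N ->
  (#|sumset A B| < #|A| + #|B|)%N -> (#|sumset A B|.+1 < #|F|)%N ->
  exists2 d : F, d != 0 & ap d A /\ ap d B.
Proof.
have [k] := ubnP #|B|; elim: k A B => // k IHk A B leBk A1 B1 ltAB ltF.
have A0 : A != set0 by rewrite -card_gt0; lia.
have [b0 b0B] : exists b, b \in B by apply/set0Pn; rewrite -card_gt0; lia.
case: (leqP #|B| 2) => [B2|B3].
  have /card_gt1P[b1 [b2 [b1B b2B b12]]] := B1.
  exists (b2 - b1); first by rewrite subr_eq0 eq_sym.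
  have eB : B = shift b1 [set 0; b2 - b1].
    apply/eqP; rewrite eq_sym eqEcard card_shift cards2 eq_sym subr_eq0 eq_sym b12.
    rewrite B2 andbT; apply/subsetP=> x; rewrite !inE subr_eq0 => /orP[/eqP->//|].
    by rewrite (inj_eq (addIr _)) => /eqP->.
  split.
    rewrite ap_sum2 -(card_shift b1) -sumset_shiftr -eB; lia.
  rewrite eB ap_shift /ap; apply: (@leq_trans #|[set b2 - b1]|); last by rewrite cards1.
  apply/subset_leq_card/subsetP => x; rewrite !inE => /andP[/orP[]/eqP-> //].
  by rewrite add0r eqxx orbT.
have [/existsP[e /andP[eA /andP[lt1 ltB]]]|] :=
  boolP [exists e in A, (1 < #|B :&: shift (b0 - e) A| < #|B|)%N].
  pose A' := A :|: shift (e - b0) B; pose B' := B :&: shift (- (e - b0)) A.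
  have eB' : B' = B :&: shift (b0 - e) A by rewrite /B' opprB.
  have cAB : (#|A'| + #|B'| = #|A| + #|B|)%N := dyson_card _ _ _.
  have sAB : sumset A' B' \subset sumset A B := dyson_sub _ _ _.
  have lAB := subset_leq_card sAB.
  have A'1 : (1 < #|A'|)%N by rewrite (leq_trans A1) // subset_leq_card // subsetUl.
  have [|||||d d0 [apA' apB']] := IHk A' B'; rewrite ?eB' // -?eB'.
  - by rewrite eB' (leq_trans ltB).
  - by rewrite cAB (leq_ltn_trans lAB).
  - exact: leq_ltn_trans ltF.
  exists d => //; apply: ap_of_sumset => //.
  (* The transformed sumset lies in the original one, and Cauchy-Davenport makes the sizes agree. *)
  suff <- : sumset A' B' = sumset A B by apply: ap_sumset.
  apply/eqP; rewrite eqEcard sAB /=.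
  have : (#|A'| + #|B'| <= #|sumset A' B'|.+1)%N.
    apply: cauchy_davenport; rewrite -?card_gt0 ?eB'; try lia.
    by apply/eqP=> /card_setT_F; rewrite -eB'; lia.
  by rewrite cAB => /(leq_trans ltAB); rewrite ltnS.
move/existsPn=> noe.
have inB' e : e \in A -> b0 \in B :&: shift (b0 - e) A.
  by move=> eA; rewrite !inE b0B opprB addrC subrK.
(* Now each [e] in [A] either leaves [B] whole or reduces it to [{b0}]: the first kind forms [X],
   the second [Y]. *)
pose X := [set e in A | B \subset shift (b0 - e) A].
pose Y := A :\: X; pose B0 := B :\ b0.
have cB0 : #|B| = #|B0|.+1 by rewrite (cardsD1 b0) b0B.
have cXY : (#|X| + #|Y| = #|A|)%N.
  rewrite -(cardsID X A); congr (_ + _)%N; apply: eq_card => x.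
  by rewrite !inE; case: (x \in A).
have dis : shift b0 A :&: sumset Y B0 = set0.
  apply/setP=> z; rewrite [RHS]inE inE [z \in shift _ _]inE; apply/negP=> /andP[zA].
  move=> /imset2P[e b]; rewrite !inE => /andP[nX eA] /andP[bb0 bB] ez.
  rewrite eA /= in nX; have := noe e; rewrite eA /=.
  have lB : (#|B :&: shift (b0 - e) A| < #|B|)%N.
    by apply/proper_card; rewrite properE subsetIl /= subsetI subxx.
  rewrite lB andbT => /negP[]; apply/card_gt1P; exists b0, b.
  rewrite inB' // !inE bB opprB addrA [b + e]addrC -ez zA; split=> //.
  by rewrite eq_sym.
(* If [Y] were empty, [A] would be stable under translation by some nonzero [b - b0]. *)
have Y0 : Y != set0.
  apply: contraTneq isT => Y0; rewrite Y0 cards0 addn0 in cXY.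
  have XA : X = A.
    apply/eqP; rewrite eqEcard cXY leqnn andbT; apply/subsetP=> x; rewrite inE.
    by case/andP.
  have /card_gt1P[b1 [b2 [b1B b2B b12]]] := B1.
  have AT : A = setT.
    have [b [bB bb0]] : exists b, b \in B /\ b != b0.
      by case: (eqVneq b1 b0) b12 => [->|nb _]; [exists b2; rewrite eq_sym | exists b1].
    apply: (@closedT (b - b0)); rewrite ?subr_eq0 // => x xA.
    move: (xA); rewrite -{1}XA inE xA /= => /subsetP/(_ _ bB).
    by rewrite inE opprB addrCA.
  have := card_le_sumset A b0B; have := card_setT_F AT; lia.
have B00 : B0 != set0 by rewrite -card_gt0; lia.
have sYAB : shift b0 A :|: sumset Y B0 \subset sumset A B.
  rewrite subUset (sumsetS (subsetDl _ _) (subsetDl _ _)) andbT.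
  by apply/subsetP=> z; rewrite inE => zA; rewrite -(subrK b0 z) mem_sumset.
have := subset_leq_card sYAB; rewrite cardsU dis cards0 subn0 card_shift => lYAB.
have lY : (#|Y| + #|B0| <= #|sumset Y B0|.+1)%N.
  by apply: cauchy_davenport => //; apply/eqP=> /card_setT_F eT; lia.
(* [A + b0] and [Y + B0] are disjoint parts of the sumset, which leaves room for only one element in
   [Y]. So [X] is nearly all of [A], yet [X + B] fits into [A + b0]. *)
have Y1 : (#|Y| <= 1)%N by lia.
have X0 : X != set0 by rewrite -card_gt0; lia.
have B0' : B != set0 by rewrite -card_gt0; lia.
have sX : sumset X B \subset shift b0 A.
  apply/subsetP=> _ /imset2P[e b + bB ->]; rewrite !inE => /andP[eA /subsetP sB].
  by have := sB _ bB; rewrite inE opprB addrA [b + e]addrC.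
have lX : (#|X| + #|B| <= #|sumset X B|.+1)%N.
  apply: cauchy_davenport => //; apply/eqP => /card_setT_F eT.
  have := subset_leq_card sX; rewrite card_shift; have := card_le_sumset A b0B; lia.
have := subset_leq_card sX; rewrite card_shift; lia.
Qed.

Lemma mulrn_eq0_ge d n : d != 0 -> (0 < n)%N -> d *+ n = 0 -> (#|F| <= n)%N.
Proof.
move=> d0 n0 dn0; pose P : {set F} := [set d *+ (j : 'I_n) | j : 'I_n].
have <- : #|P| = #|F|.
  apply/card_setT_F/(closedT d0); first by apply/set0Pn; exists (d *+ 0); apply/imsetP; exists (Ordinal n0).
  move=> _ /imsetP[j _ ->]; apply/imsetP.
  have [jn|jn] := ltnP j.+1 n; first by exists (Ordinal jn) => //=; rewrite mulrSr.
  exists (Ordinal n0) => //=; rewrite -mulrSr mulr0n -dn0; congr (_ *+ _).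
  by apply/eqP; rewrite eqn_leq jn ltn_ord.
by rewrite -[X in (_ <= X)%N]card_ord leq_imset_card.
Qed.

Lemma mulrn_inj d : d != 0 -> {in gtn #|F| &, injective (fun n => d *+ n)}.
Proof.
move=> d0 i j; wlog ij : i j / (i <= j)%N.
  by move=> h iF jF e; case/orP: (leq_total i j) => ij; [exact: h | exact/esym/h].
move=> _ jF /eqP; rewrite eq_sym -subr_eq0 -mulrnBr // => /eqP e0.
apply/eqP; rewrite eqn_leq ij leqNgt -subn_gt0; apply/negP => n0.
by have := mulrn_eq0_ge d0 n0 e0; rewrite leqNgt (leq_ltn_trans (leq_subr _ _)).
Qed.

(** Going back from the end [a], an exit before [#|A|] steps would leave a nonempty remainder of [A]
    stable under adding [d], hence equal to [F], although it misses [a]. *)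
Lemma ap_eq_progression d A a : d != 0 -> ap d A -> a \in ends d A ->
  A = [set a - d *+ (j : 'I_#|A|) | j : 'I_#|A|].
Proof.
move=> d0 apA aE; have := aE; rewrite inE => /andP[aA adA].
pose P k : {set F} := [set a - d *+ (j : 'I_k) | j : 'I_k].
have cP : #|P #|A| | = #|A|.
  rewrite card_imset ?card_ord // => i j /(congr1 (fun x => a - x)); rewrite !subKr.
  move=> /(mulrn_inj d0) eij; apply/val_inj/eij; rewrite inE /=;
    exact: leq_trans (ltn_ord _) (card_le_F A).
apply/esym/eqP; rewrite eqEcard -/(P _) cP leqnn andbT.
suff: forall k, (k <= #|A|)%N -> P k \subset A by apply.
elim=> [|k IHk] kA; first by apply/subsetP=> x /imsetP[[]].
have sPA := IHk (ltnW kA).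
suff akA : a - d *+ k \in A.
  apply/subsetP=> x /imsetP[[j jk1] _ ->] /=.
  have /orP[/eqP-> //|jk] : (j == k) || (j < k)%N by rewrite -leq_eqVlt.
  by apply: (subsetP sPA); apply/imsetP; exists (Ordinal jk).
apply: contraT => nk; have k0 : (0 < k)%N.
  by rewrite lt0n; apply: contraNneq nk => ->; rewrite mulr0n subr0.
have aP : a \in P k by apply/imsetP; exists (Ordinal k0); rewrite //= mulr0n subr0.
have C0 : A :\: P k != set0.
  rewrite -card_gt0 cardsD (setIidPr sPA) subn_gt0 (leq_ltn_trans _ kA) //.
  by rewrite -[X in (_ <= X)%N]card_ord leq_imset_card.
have /setP/(_ a) : A :\: P k = setT; last by rewrite !inE aP.
apply: (closedT d0 C0) => x; rewrite !inE => /andP[xP xA].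
have xdA : x + d \in A.
  apply: contraNT xP => xdA; suff -> : x = a by [].
  by apply: (card_le1_eqP apA) => //; rewrite inE xA.
rewrite xdA andbT; apply: contra xP => /imsetP[[j jk] _ /= /eqP].
rewrite eq_sym subr_eq -addrA -mulrS -subr_eq => /eqP ex.
move: jk; rewrite -ex leq_eqVlt => /orP[/eqP jk|jk]; last by apply/imsetP; exists (Ordinal jk).
by move: nk; rewrite -jk ex xA.
Qed.

Lemma ap_eq_shift d A B : d != 0 -> ap d A -> ap d B -> #|A| = #|B| ->
  A != set0 -> A != setT -> exists s, A = shift s B.
Proof.
move=> d0 apA apB cAB A0 AT.
have ex_end X : X != set0 -> X != setT -> exists a, a \in ends d X.
  move=> X0 XT; apply/set0Pn; apply: contra XT => /eqP/setP E0; apply/eqP/(closedT d0 X0).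
  by move=> x xX; have := E0 x; rewrite !inE xX => /negbFE.
have [a aE] := ex_end A A0 AT.
have [||b bE] := ex_end B.
- by rewrite -card_gt0 -cAB card_gt0.
- by apply: contra AT => /eqP eB; rewrite eqEcard subsetT cAB eB leqnn.
exists (a - b); apply/setP => x.
rewrite (ap_eq_progression d0 apA aE) inE (ap_eq_progression d0 apB bE) cAB.
apply/imsetP/imsetP => -[j _ e]; exists j => //.
  by rewrite e opprB addrC addrA subrK.
by rewrite -(subrK (a - b) x) e addrC addrA subrK.
Qed.

End Sumsets.

(** * Rigidity of a pair of lines *)

Section LayerCake.
Local Open Scope nat_scope.

Lemma sum_ltn k w : \sum_(l < w) (l < k) = minn k w.
Proof.
elim: w => [|w IHw]; first by rewrite big_ord0 minn0.
by rewrite big_ord_recr IHw /=; lia.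
Qed.

Variables (T : finType) (A : {set T}) (f : T -> nat).

Lemma sum_card_minn w :
  \sum_(l < w) #|[set x in A | l < f x]| = \sum_(x in A) minn (f x) w.
Proof.
rewrite (eq_bigr (fun l : 'I_w => \sum_(x in A) (l < f x))); last first.
  move=> l _; rewrite -sum1_card [RHS]big_mkcond [LHS]big_mkcond /=.
  by apply: eq_bigr => x _; rewrite inE; case: (x \in A); case: (l < f x).
by rewrite exchange_big; apply: eq_bigr => x _; rewrite sum_ltn.
Qed.

Lemma layer_cake w : {in A, forall x, f x <= w} ->
  \sum_(x in A) f x = \sum_(l < w) #|[set x in A | l < f x]|.
Proof.
by move=> fw; rewrite sum_card_minn; apply: eq_bigr => x xA; rewrite (minn_idPl (fw x xA)).
Qed.

Lemma layer_cake_le w : \sum_(l < w) #|[set x in A | l < f x]| <= \sum_(x in A) f x.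
Proof. by rewrite sum_card_minn; apply: leq_sum => x _; rewrite geq_minl. Qed.

End LayerCake.

Lemma subset_of_card (T : finType) (A : {set T}) k : (k <= #|A|)%N ->
  exists2 B : {set T}, B \subset A & #|B| = k.
Proof.
move=> kA; exists [set x in take k (enum A)].
  by apply/subsetP=> x; rewrite inE => /mem_take; rewrite mem_enum.
rewrite cardsE (card_uniqP _) ?take_uniq ?enum_uniq // size_take -cardE.
by case: ltngtP kA.
Qed.

Section Lines.
Variable F : finFieldType.
Hypothesis natF : forall x : F, exists n, x = n%:R.
Variables (m w : nat) (I : {set F}).
Hypothesis cF : #|F|.+1 = (3 * m)%N.
Hypothesis cI : #|I| = m.

Definition supp (b : F -> nat) : {set F} := [set x | 0 < b x]%N.

Lemma sum_supp (b : F -> nat) : (\sum_x b x = \sum_(x in supp b) b x)%N.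
Proof.
rewrite [RHS]big_mkcond; apply: eq_bigr => x _; rewrite inE.
by case: posnP.
Qed.

Section Pair.
(** In the application [b] and [b'] are the fibre sizes along the lines [k] and [k + g], and [d i]
    is the shortfall from [w] at the offset [i] of the line [g], so that [D] is the deficit of
    [g]. *)
Variables (b b' : F -> nat) (d : F -> nat).
Hypothesis bw : forall x, (b x <= w)%N.
Hypothesis dw : forall i, (d i <= w)%N.
Hypothesis bd : forall x i, i \in I -> (0 < b x)%N -> (0 < b' (x + i)%R)%N -> (b x <= d i)%N.
Let D := (\sum_(i in I) d i)%N.

(* For a level [l] at or above the least [d i], the superlevel set of [b] plus
   the set of [i] with [d i <= l] misses [Z]; Cauchy-Davenport bounds the former. *)
Lemma sum_level_bound (Z : {set F}) i0 : i0 \in I -> {in I, forall i, d i0 <= d i}%N ->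
  Z \subset supp b' -> Z != set0 -> (#|Z| <= 2 * m)%N ->
  (\sum_x b x + d i0 * (m + (2 * m - #|Z|)) <=
     d i0 * #|supp b| + w * (2 * m - #|Z|) + D)%N.
Proof.
move=> i0I d0 sZ Z0 cZ; rewrite sum_supp /D.
rewrite (@layer_cake _ _ b w) // (@layer_cake _ _ d w) //.
have -> : (d i0 = \sum_(l < w) (l < d i0))%N by rewrite sum_ltn (minn_idPl (dw _)).
rewrite !big_distrl /= -[X in (_ <= _ + X * _ + _)%N]card_ord -sum_nat_const.
rewrite -!big_split /=; apply: leq_sum => l _.
case: ltnP => ld.
  have -> : [set i in I | (l < d i)%N] = I.
    by apply/setP=> i; rewrite inE; case: (boolP (i \in I)) => // /d0 /(leq_trans ld) ->.
  rewrite cI !mul1n; have : (#|[set x in supp b | l < b x]| <= #|supp b|)%N.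
    by apply/subset_leq_card/subsetP=> x; rewrite inE => /andP[].
  by move=> hS; rewrite [(m + _)%N]addnC !addnA !leq_add2r.
rewrite !mul0n addn0 add0n.
set X := [set x in supp b | _]; set J := [set i in I | (l < d i)%N].
have [->|X0] := eqVneq X set0; first by rewrite cards0.
pose J' := [set i in I | (d i <= l)%N].
have J'0 : J' != set0 by apply/set0Pn; exists i0; rewrite inE i0I.
have cJ : (#|J'| + #|J| = m)%N.
  rewrite -cI addnC -(cardsID [set i | l < d i]%N I).
  by congr (_ + _)%N; apply: eq_card => i; rewrite !inE // -leqNgt andbC.
have sXJ : sumset X J' \subset ~: Z.
  apply/subsetP=> _ /imset2P[x i + + ->]; rewrite !inE.
  move=> /andP[x0 xl] /andP[iI il]; apply/negP=> /(subsetP sZ); rewrite inE => xi0.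
  by have := bd iI x0 xi0; lia.
have := cauchy_davenport_setC natF X0 J'0 Z0 sXJ; rewrite cF.
move: #|X| #|J'| #|J| #|Z| cJ cZ; clear; lia.
Qed.

(** In [sum_level_bound], the choice [#|Z| = m + 1] absorbs the terms in [d i0] when [supp b] has
    fewer than [2m] points. Otherwise [#|Z| = 2m] is used, and the assumption on [D] bounds the
    remaining [(2m - 1) * d i0], because [m * d i0 <= D]. *)
Lemma sum_le_of_big_supports : (0 < m)%N -> (m < #|supp b|)%N -> (#|supp b| <= #|supp b'|)%N ->
  ((2 * m - 1) * D <= m * (m - 1) * w)%N ->
  (\sum_x b x <= (m - 1) * w + D)%N.
Proof.
move=> m0 mb bb' hD.
have [i0 i0I d0] : exists2 i0, i0 \in I & {in I, forall i, d i0 <= d i}%N.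
  have [i iI] : exists i, i \in I by apply/set0Pn; rewrite -card_gt0 cI.
  by case: (arg_minnP d iI) => i0 i0I d0; exists i0.
have mD : (m * d i0 <= D)%N.
  by rewrite -cI -sum_nat_const; apply: leq_sum.
have [s1|s2] := leqP #|supp b| (2 * m - 1).
  have [Z sZ cZ] := subset_of_card (leq_trans mb bb').
  have Z0 : Z != set0 by rewrite -card_gt0 cZ.
  have := sum_level_bound i0I d0 sZ Z0; rewrite cZ => /(_ ltac:(lia)).
  have : (d i0 * #|supp b| <= d i0 * (2 * m - 1))%N by rewrite leq_mul2l s1 orbT.
  have -> : (m + (2 * m - m.+1) = 2 * m - 1)%N by lia.
  have -> : (2 * m - m.+1 = m - 1)%N by lia.
  by rewrite [(w * _)%N]mulnC; lia.
have [Z sZ cZ] := @subset_of_card _ (supp b') (2 * m) ltac:(lia).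
have Z0 : Z != set0 by rewrite -card_gt0 cZ; lia.
have := sum_level_bound i0I d0 sZ Z0; rewrite cZ subnn addn0 muln0 addn0 => /(_ (leqnn _)).
have : (d i0 * #|supp b| <= d i0 * (3 * m - 1))%N.
  by rewrite leq_mul2l; have := card_le_F (supp b); lia.
have : ((2 * m - 1) * d i0 <= (m - 1) * w)%N.
  rewrite -(leq_pmul2l m0) mulnA (leq_trans _ (leq_trans hD _)) ?mulnA //.
  by rewrite [(m * _)%N]mulnC -mulnA leq_mul2l mD orbT.
have -> : (d i0 * (3 * m - 1) = d i0 * m + (2 * m - 1) * d i0)%N.
  by rewrite [(_ * d i0)%N]mulnC -mulnDr; congr (_ * _)%N; lia.
lia.
Qed.

Lemma supp_ge : ((m - 1) * w < \sum_x b x)%N -> (m <= #|supp b|)%N.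
Proof.
rewrite sum_supp => lt; have : (\sum_(x in supp b) b x <= #|supp b| * w)%N.
  by rewrite -sum_nat_const; apply: leq_sum.
move=> /(leq_trans lt); rewrite ltn_mul2r => /andP[_]; lia.
Qed.

Lemma small_supp_gt : #|supp b| = m -> ((m - 1) * w + D < \sum_x b x)%N ->
  {in supp b, forall x, (D < b x)%N}.
Proof.
move=> cS lt x xS; move: lt; rewrite sum_supp (bigD1 x) //=.
have : (\sum_(i in supp b | i != x) b i <= (m - 1) * w)%N.
  apply: (@leq_trans (\sum_(i in supp b :\ x) w)%N).
    by rewrite (eq_bigl (mem (supp b :\ x))) ?leq_sum // => i; rewrite !inE andbC.
  by rewrite sum_nat_const (cardsD1 x) xS in cS *; rewrite leq_mul2r -cS; lia.
move=> hR h; rewrite -(ltn_add2l ((m - 1) * w)); apply: leq_trans h _.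
by rewrite [(b x + _)%N]addnC leq_add2r.
Qed.

(** Each [b x] on the support exceeds [D], hence every [d i], so [bd] excludes [x + i] from
    [supp b']. *)
Lemma small_supp_disjoint : #|supp b| = m -> ((m - 1) * w + D < \sum_x b x)%N ->
  sumset (supp b) I \subset ~: supp b'.
Proof.
move=> cS lt; apply/subsetP=> _ /imset2P[x i xS iI ->]; rewrite !inE -leqNgt leqn0.
have := small_supp_gt cS lt xS; case: posnP => // xi0.
rewrite inE in xS; have := bd iI xS xi0.
have : (d i <= D)%N by rewrite /D (bigD1 i) //= leq_addr.
lia.
Qed.

End Pair.

Section Rigidity.
Variables (b b' : F -> nat) (d : F -> nat).
Hypothesis bw : forall x, (b x <= w)%N.
Hypothesis bw' : forall x, (b' x <= w)%N.
Hypothesis dw : forall i, (d i <= w)%N.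
Hypothesis bd : forall x i, i \in I -> (0 < b x)%N -> (0 < b' (x + i)%R)%N ->
  (b x <= d i)%N /\ (b' (x + i)%R <= d i)%N.
Let D := (\sum_(i in I) d i)%N.
Hypothesis m0 : (0 < m)%N.
Hypothesis hD : ((2 * m - 1) * D <= m * (m - 1) * w)%N.
Hypothesis big_b : ((m - 1) * w + D < \sum_x b x)%N.
Hypothesis big_b' : ((m - 1) * w + D < \sum_x b' x)%N.

(** The reflection [x -> - x] exchanges the roles of the two lines in [bd]. *)
Let nb x := b (- x).
Let nb' x := b' (- x).

Let supp_opp (c : F -> nat) : supp (fun x => c (- x)) = oppset (supp c).
Proof. by apply/setP=> x; rewrite !inE. Qed.

Let sum_opp (c : F -> nat) : (\sum_x c (- x)%R = \sum_x c x)%N.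
Proof. by rewrite [RHS](reindex_inj (@oppr_inj F)). Qed.

Let nbd x i : i \in I -> (0 < nb' x)%N -> (0 < nb (x + i)%R)%N -> (nb' x <= d i)%N.
Proof.
move=> iI x0 xi0; have [] := bd (x := - (x + i)) iI xi0; rewrite opprD subrK //.
Qed.

Let bd1 x i : i \in I -> (0 < b x)%N -> (0 < b' (x + i)%R)%N -> (b x <= d i)%N.
Proof. by move=> iI x0 xi0; have [] := bd iI x0 xi0. Qed.

(** If one support has exactly [m] points, disjointness and Cauchy-Davenport bound the other by [m].
    If both have more, [sum_le_of_big_supports] contradicts the total on the line with the smaller
    support. *)
Lemma rigid_card : #|supp b| = m /\ #|supp b'| = m.
Proof.
have lb : (m <= #|supp b|)%N by apply: supp_ge => //; apply: leq_ltn_trans (leq_addr _ _) big_b.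
have lb' : (m <= #|supp b'|)%N by apply: supp_ge => //; apply: leq_ltn_trans (leq_addr _ _) big_b'.
have I0 : I != set0 by rewrite -card_gt0 cI.
have cb : #|supp b| = m -> #|supp b'| = m.
  move=> e; have := small_supp_disjoint bw bd1 e big_b.
  move/(cauchy_davenport_setC natF); rewrite -!card_gt0 e cI cF => h.
  apply/eqP; rewrite eqn_leq lb' andbT; have := h _ _ _; lia.
have cb' : #|supp b'| = m -> #|supp b| = m.
  move=> e; have := @small_supp_disjoint nb' nb d _ nbd; rewrite supp_opp card_oppset e sum_opp.
  move=> /(_ (fun x => bw' (- x)) erefl big_b').
  move/(cauchy_davenport_setC natF); rewrite -!card_gt0 supp_opp !card_oppset e cI cF => h.
  apply/eqP; rewrite eqn_leq lb andbT; have := h _ _ _; lia.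
have [e|n1] := eqVneq #|supp b| m; first by split; last exact: cb.
have [e|n2] := eqVneq #|supp b'| m; first by split; first exact: cb'.
have [le|/ltnW le] := leqP #|supp b| #|supp b'|.
  have := sum_le_of_big_supports bw dw bd1 m0 _ le hD.
  have mb : (m < #|supp b|)%N by rewrite ltn_neqAle eq_sym n1.
  by move=> /(_ mb); rewrite leqNgt big_b.
have := @sum_le_of_big_supports nb' nb d (fun x => bw' (- x)) dw nbd m0.
rewrite !supp_opp !card_oppset sum_opp => /(_ _ le hD).
have mb' : (m < #|supp b'|)%N by rewrite ltn_neqAle eq_sym n2.
by move=> /(_ mb'); rewrite leqNgt big_b'.
Qed.

Hypothesis apI : ap 1 I.

(** [S + I] has at most [2m - 1] elements, so the pair is critical and [S] inherits the difference
    of [I]. *)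
Let ap_of_disjoint (S T : {set F}) : #|S| = m -> #|T| = m -> sumset S I \subset ~: T -> ap 1 S.
Proof.
move=> cS cT sST; case: (leqP m 1) => [m1|m1].
  rewrite /ap (leq_trans _ m1) // -cS; apply/subset_leq_card/subsetP=> x.
  by rewrite inE => /andP[].
have := subset_leq_card sST; have := card_setC_F T; rewrite cT => cTC lS.
apply: (ap_critical natF (oner_neq0 F) apI); rewrite ?cI -?card_gt0 ?cS // sumsetC.
  by apply/eqP=> /card_setT_F; lia.
lia.
Qed.

Lemma rigid_ap : ap 1 (supp b) /\ ap 1 (supp b').
Proof.
have [cS cS'] := rigid_card; split.
  exact: ap_of_disjoint cS cS' (small_supp_disjoint bw bd1 cS big_b).
apply: ap_opp; rewrite -supp_opp.
apply: (@ap_of_disjoint _ (supp nb)); rewrite ?supp_opp ?card_oppset //.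
rewrite -!supp_opp; apply: (small_supp_disjoint (d := d)) => //.
  by rewrite supp_opp card_oppset.
by rewrite sum_opp.
Qed.

End Rigidity.
End Lines.

(** * Sumset of two graphs in the plane *)

Section Staircase.
Local Open Scope nat_scope.
(** The values [h s], [l t], [r k] stand for the numbers of rows with more than [s], [t], [k] points
    in the graph over [G], the graph over [E] and their sumset; [A] and [B] are then [#|G|] and
    [#|E|]. *)
Variables (p ga M : nat) (h l r : nat -> nat).
Hypothesis ga1 : 1 < ga.
Hypothesis gaM : ga <= M.
Hypothesis h_anti : {homo h : s t / s <= t >-> t <= s}.
Hypothesis l_anti : {homo l : s t / s <= t >-> t <= s}.
Hypothesis h_pos : forall s, s < ga -> 0 < h s.
Hypothesis hl : forall s, h s <= l s.
Hypothesis h0 : 1 < h 0.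
Hypothesis r_ge : forall s t, s < ga -> t < M -> minn p (h s + l t - 1) <= r (s + t).
Let A := \sum_(0 <= s < ga) h s.
Let B := \sum_(0 <= t < M) l t.
Hypothesis AB : p.+2 <= A + B.
Hypothesis Bp : B <= p.

Lemma last_of_plateau : exists T, [/\ 0 < T, T < ga, h T = h 1
  & forall s, T < s -> s < ga -> h s < h 1].
Proof.
have ex : exists T, (T < ga) && (h T == h 1) by exists 1; rewrite ga1 eqxx.
have bnd T : (T < ga) && (h T == h 1) -> T <= ga by case/andP=> /ltnW.
case: (ex_maxnP ex bnd) => T /andP[Tga /eqP hT] maxT; exists T; split=> //.
  by apply: (maxT 1); rewrite ga1 eqxx.
move=> s Ts sga; rewrite ltn_neqAle h_anti ?andbT; last by lia.
by apply: contraL Ts => hs; rewrite -leqNgt maxT // sga.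
Qed.

Lemma l0l1B : l 0 + l 1 <= B.
Proof.
rewrite /B big_ltn; last by lia.
by rewrite big_ltn ?leq_add2l ?leq_addr //; lia.
Qed.

(** For [t > 0] the cap [p] has no effect: [h s + l t <= l 0 + l 1 <= B <= p]. *)
Lemma r_ge_far s t : s < ga -> t < M -> 0 < t -> h s + l t <= (r (s + t)).+1.
Proof.
move=> sga tM t0; have := r_ge sga tM.
have : h s + l t <= p.
  apply: leq_trans Bp; apply: leq_trans l0l1B; apply: leq_add; last exact: l_anti.
  by apply: leq_trans (hl 0); apply: h_anti.
by have := h_pos sga; lia.
Qed.

(* The [ga + M - 1] levels are reached along the path (0,0), (0,1), ..., (0,T),
   (1,T), ..., (ga-1,T), (ga-1,T+1), ..., (ga-1,M-1), where [T] is the last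
   index with [h T = h 1]. *)
Lemma staircase_sum : p + A <= (\sum_(0 <= k < ga + M - 1) r k).+1.
Proof.
have [T [T0 Tga hT hlt]] := last_of_plateau.
have TM : T < M by apply: leq_trans gaM.
pose S2 := \sum_(1 <= t < T.+1) l t; pose S4 := \sum_(T.+1 <= t < M) l t.
have eB : B = l 0 + S2 + S4.
  rewrite /B big_ltn; last by lia.
  by rewrite (@big_cat_nat _ _ _ T.+1) //= addnA.
pose A1 := \sum_(1 <= s < ga) h s.
have eA : A = h 0 + A1 by rewrite /A big_ltn //; lia.
(* Each term beyond [T] is smaller than [h 1] and saves one. *)
have A1le : A1 + (ga - T.+1) <= (ga - 1) * h 1.
  rewrite /A1 (@big_cat_nat _ _ _ T.+1) //=.
  have : \sum_(1 <= s < T.+1) h s <= T * h 1.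
    rewrite -[X in X * _](subn1 T.+1) -sum_nat_const_nat !big_nat.
    by apply: leq_sum => s /andP[s1 _]; apply: h_anti.
  have : \sum_(T.+1 <= s < ga) h s + (ga - T.+1) <= (ga - T.+1) * h 1.
    rewrite -[X in _ + X]muln1 -!sum_nat_const_nat -big_split /= !big_nat.
    by apply: leq_sum => s /andP[s1 s2]; rewrite addn1 hlt.
  have -> : ga - 1 = T + (ga - T.+1) by lia.
  rewrite mulnDl; lia.
have A1ge : h 1 <= A1 by rewrite /A1 big_ltn // leq_addr.
(* Only the corner (0,0) of the path can be subject to the cap [p]. *)
have r0 : minn p (h 0 + l 0 - 1) <= r 0 by apply: (r_ge (s := 0) (t := 0)); lia.
have -> : \sum_(0 <= k < ga + M - 1) r k =
   r 0 + \sum_(1 <= t < T.+1) r t + \sum_(1 <= s < ga) r (s + T)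
     + \sum_(T.+1 <= t < M) r (t + (ga - 1)).
  rewrite big_ltn; last by lia.
  rewrite (@big_cat_nat _ _ _ T.+1) //=; last by lia.
  rewrite (@big_cat_nat _ _ _ (ga + T) T.+1) //=; try by lia.
  have -> : \sum_(T.+1 <= i < ga + T) r i = \sum_(1 <= s < ga) r (s + T).
    by rewrite -[T.+1]add1n big_addn addnK.
  have -> : \sum_(ga + T <= i < ga + M - 1) r i = \sum_(T.+1 <= t < M) r (t + (ga - 1)).
    have -> : ga + T = T.+1 + (ga - 1) by lia.
    by rewrite big_addn; have -> : ga + M - 1 - (ga - 1) = M by lia.
  by rewrite !addnA.
have c2 : S2 + T * h 0 <= \sum_(1 <= t < T.+1) r t + T.
  suff : S2 + (T.+1 - 1) * h 0 <= \sum_(1 <= t < T.+1) r t + (T.+1 - 1) * 1.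
    by rewrite subn1 muln1.
  rewrite -!sum_nat_const_nat -!big_split /= !big_nat; apply: leq_sum => t /andP[t1 t2].
  rewrite addnC addn1 -[r t]/(r (0 + t)); apply: r_ge_far; lia.
have c3 : A1 + (ga - 1) * l T <= \sum_(1 <= s < ga) r (s + T) + (ga - 1).
  rewrite -[X in _ <= _ + X]muln1 -!sum_nat_const_nat -!big_split /= !big_nat.
  by apply: leq_sum => s /andP[s1 s2]; rewrite addn1; apply: r_ge_far.
have c4 : S4 <= \sum_(T.+1 <= t < M) r (t + (ga - 1)).
  rewrite /S4 !big_nat; apply: leq_sum => t /andP[t1 t2].
  have g1 : ga - 1 < ga by lia.
  have := r_ge_far g1 t2 (leq_ltn_trans (leq0n T) t1); have := h_pos g1.
  by rewrite [_ + t]addnC; lia.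
have hlT : (ga - 1) * h 1 <= (ga - 1) * l T by rewrite leq_mul2l -hT hl orbT.
have b0 := hl 0; have b1 := hl 1; have b2 := h_pos ga1; have := l0l1B.
(* This is [(T - 1) * (h 0 - 2) >= 0]. *)
have : 2 * T + h 0 <= T * h 0 + 2.
  case: T T0 {Tga hT hlt TM S2 S4 eB A1le c2 c3 c4 hlT} => // T _.
  by rewrite mulSn; nia.
move: (T * h 0) ((ga - 1) * h 1) ((ga - 1) * l T) A1le c2 c3 hlT => X Y Z.
move: r0 AB; rewrite eA eB.
case: leqP; lia.
Qed.

End Staircase.

Lemma sum_card_fibres (T : finType) (U : finType) (A : {set T}) (f : T -> U) :
  (\sum_u #|[set x in A | f x == u]| = #|A|)%N.
Proof.
rewrite -[RHS]sum1_card (partition_big f xpredT) //=; apply: eq_bigr => u _.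
by rewrite -sum1_card; apply: eq_bigl => x; rewrite inE.
Qed.

Section Graph.
Variable F : finFieldType.
Hypothesis natF : forall x : F, exists n, x = n%:R.
(** The points [x1], [x2], [y1] witness that the graph of [f] over [G] is not contained in a line; a
    shear has brought the first two to equal height, so that points can be counted by rows. *)
Variables (G E : {set F}) (f : F -> F) (x1 x2 y1 : F).
Hypothesis GE : G \subset E.
Hypothesis cGE : (#|F|.+2 <= #|G| + #|E|)%N.
Hypothesis x1G : x1 \in G.
Hypothesis x2G : x2 \in G.
Hypothesis y1G : y1 \in G.
Hypothesis x12 : x1 != x2.
Hypothesis fx12 : f x1 = f x2.
Hypothesis fy1 : f y1 != f x1.

Definition graph_sum : {set F * F} := [set (x + y, f x + f y) | x in G, y in E].

Let Gf u : {set F} := [set x in G | f x == u].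
Let Ef v : {set F} := [set x in E | f x == v].
Let g u := #|Gf u|.
Let e v := #|Ef v|.
Let n z := #|[set q in graph_sum | q.2 == z]|.
Let lev (h : F -> nat) s : {set F} := [set u in [set: F] | (s < h u)%N].
Let ga := \max_u g u.
Let M := \max_v e v.

Let ex_max (h : F -> nat) : exists u, h u = \max_v h v.
Proof.
by case: (@bigop.eq_bigmax F h) => [|u ->]; [rewrite (cardD1 x1) | exists u].
Qed.

Let sum_lev h w : (forall u, h u <= w)%N -> (\sum_(0 <= s < w) #|lev h s| = \sum_u h u)%N.
Proof.
move=> hw; rewrite big_mkord -(@layer_cake _ _ h w) //.
by apply: eq_bigl => u; rewrite inE.
Qed.

Let g_le u : (g u <= ga)%N. Proof. exact: leq_bigmax. Qed.
Let e_le v : (e v <= M)%N. Proof. exact: leq_bigmax. Qed.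
Let ge u : (g u <= e u)%N.
Proof.
by apply/subset_leq_card/subsetP=> x; rewrite !inE => /andP[/(subsetP GE) -> ->].
Qed.
Let sum_g : (\sum_u g u = #|G|)%N. Proof. exact: sum_card_fibres. Qed.
Let sum_e : (\sum_u e u = #|E|)%N. Proof. exact: sum_card_fibres. Qed.

Let n_ge u v : (#|sumset (Gf u) (Ef v)| <= n (u + v)%R)%N.
Proof.
have injp : injective (fun z : F => (z, u + v)) by move=> z t [].
rewrite -(card_imset _ injp); apply/subset_leq_card/subsetP=> _ /imsetP[_ /imset2P[x y + + ->] ->].
rewrite !inE => /andP[xG /eqP <-] /andP[yE /eqP <-]; rewrite /= eqxx andbT.
by apply/imset2P; exists x y.
Qed.

Let n_ge_min u v : (0 < g u)%N -> (0 < e v)%N -> (minn #|F| (g u + e v - 1) <= n (u + v)%R)%N.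
Proof.
rewrite !card_gt0 => u0 v0; apply: leq_trans (n_ge u v).
have [/card_setT_F ->|/(cauchy_davenport natF u0 v0)] := eqVneq (sumset (Gf u) (Ef v)) setT.
  exact: geq_minl.
by rewrite -/(g u) -/(e v); lia.
Qed.

Let Gf_Ef_disjoint u v : u != v -> (g u + e v <= #|F|)%N.
Proof.
move=> uv; rewrite -cardsUI; have -> : Gf u :&: Ef v = set0.
  apply/setP=> x; rewrite !inE; apply: contraNF uv => /andP[/andP[_ /eqP <-] /andP[_ /eqP <-]].
  exact: eqxx.
by rewrite cards0 addn0 card_le_F.
Qed.

Let ga1 : (1 < ga)%N.
Proof.
apply: leq_trans (g_le (f x1)); apply/card_gt1P; exists x1, x2.
by rewrite !inE x1G x2G fx12 eqxx.
Qed.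

Let gaM : (ga <= M)%N.
Proof. by apply/bigmax_leqP=> u _; apply: leq_trans (ge u) (e_le u). Qed.

Let sum_n : (\sum_z n z = #|graph_sum|)%N. Proof. exact: sum_card_fibres. Qed.

(* Cauchy-Davenport is capped at [p] only if the richest fibres of [G] and [E]
   coincide; their sum then is a full line. *)
Let capped_case : (#|F|.+1 < ga + M)%N -> (#|F| + #|G| <= #|graph_sum|.+1)%N.
Proof.
have [u0 gu0] : exists u, g u = ga := ex_max g.
have [v0 ev0] : exists v, e v = M := ex_max e.
move=> cap; have uv0 : u0 = v0.
  by apply: contraTeq cap => /Gf_Ef_disjoint; rewrite gu0 ev0 -leqNgt => /leqW.
have [u1 u10 gu1] : exists2 u1, u1 != u0 & (0 < g u1)%N.
  have gpos x : x \in G -> (0 < g (f x))%N.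
    by move=> xG; rewrite card_gt0; apply/set0Pn; exists x; rewrite inE xG eqxx.
  have [e1|] := eqVneq (f x1) u0; last by exists (f x1); rewrite ?gpos.
  by exists (f y1); rewrite ?gpos // -e1.
have M0 : (0 < e v0)%N by rewrite ev0; lia.
pose nv u := n (u + v0).
(* A row other than [u0] has no abscissa in common with the row [v0 = u0] of [E], so no cap
   applies. *)
have nu u : u != u0 -> (0 < g u)%N -> (g u + (M - 1) <= nv u)%N.
  move=> uu0 gu; rewrite /nv; have := n_ge_min gu M0; have := Gf_Ef_disjoint (u := u) (v := v0).
  by rewrite -uv0 => /(_ uu0); rewrite uv0 ev0; case: leqP; lia.
have n0 : (#|F| <= nv u0)%N.
  apply: leq_trans (n_ge _ _); rewrite pigeonhole_sumset ?cardsT //.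
  by rewrite -/(g u0) -/(e v0) gu0 ev0; lia.
have : (\sum_u nv u = #|graph_sum|)%N.
  by rewrite -sum_n [RHS](reindex_inj (addIr v0)).
rewrite (bigD1 u0) //= (bigD1 u1) //= => <-.
move: sum_g; rewrite (bigD1 u0) //= (bigD1 u1) //= => <-.
have := nu _ u10 gu1; rewrite gu0.
have : (\sum_(i | (i != u0) && (i != u1)) g i <= \sum_(i | (i != u0) && (i != u1)) nv i)%N.
  apply: leq_sum => u /andP[uu0 _]; case: (posnP (g u)) => [-> //|gu].
  by apply: leq_trans (nu u uu0 gu); rewrite leq_addr.
move: (\sum_(i | (i != u0) && (i != u1)) g i)%N => S.
move: (\sum_(i | (i != u0) && (i != u1)) nv i)%N => S'.
have key a b c d k : (k <= a -> b <= M -> 1 < b -> S <= S' -> c + (M - 1) <= d ->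
    k + (b + (c + S)) <= (a + (d + S')).+1)%N by clear; lia.
by move=> h1 h2; apply: key n0 gaM ga1 h1 h2.
Qed.

(** Outside the capped case Cauchy-Davenport acts twice: along rows it puts [lev g s + lev e t]
    inside [lev n (s + t)], and on the heights it bounds the size of that sumset, as [staircase_sum]
    requires. *)
Lemma card_graph_sum : (#|F| + #|G| <= #|graph_sum|.+1)%N.
Proof.
have [|nocap] := ltnP #|F|.+1 (ga + M); first exact: capped_case.
have lev_anti h : {homo (fun s => #|lev h s|) : s t / (s <= t)%N >-> (t <= s)%N}.
  move=> s t st; apply/subset_leq_card/subsetP=> u; rewrite !inE; exact: leq_ltn_trans.
have := @staircase_sum #|F| ga M (fun s => #|lev g s|) (fun t => #|lev e t|) (fun k => #|lev n k|).
rewrite (sum_lev g_le) (sum_lev e_le) sum_g sum_e => H.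
apply: leq_trans (H ga1 gaM (lev_anti g) (lev_anti e) _ _ _ _ cGE (card_le_F E)) _ => {H}.
- move=> s sga; have [u gu] : exists u, g u = ga := ex_max g.
  by rewrite card_gt0; apply/set0Pn; exists u; rewrite !inE gu.
- move=> s; apply/subset_leq_card/subsetP=> u; rewrite !inE => /leq_trans; apply; exact: ge.
- apply/card_gt1P; exists (f x1), (f y1); split; rewrite 1?eq_sym // !inE card_gt0; apply/set0Pn.
    by exists x1; rewrite inE eqxx x1G.
  by exists y1; rewrite inE eqxx y1G.
- move=> s t sga tM; have key k a b c i j : (i + j <= k.+1 -> s < a -> t < b -> a <= i -> b <= j ->
      minn k (a + b - 1) <= c -> s + t < c)%N by clear; lia.
  have sub : sumset (lev g s) (lev e t) \subset lev n (s + t).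
    apply/subsetP=> _ /imset2P[u v + + ->]; rewrite !inE /= => su tv.
    have h := n_ge_min (leq_ltn_trans (leq0n _) su) (leq_ltn_trans (leq0n _) tv).
    exact: key nocap su tv (g_le u) (e_le v) h.
  apply: leq_trans (subset_leq_card sub).
  have ne (h : F -> nat) k m : (forall u, h u <= m)%N -> m = \max_u h u -> (k < m)%N -> lev h k != set0.
    move=> _ -> km; have [u hu] := ex_max h.
    by apply/set0Pn; exists u; rewrite !inE hu.
  have g0 := ne g s ga g_le erefl sga; have e0 := ne e t M e_le erefl tM.
  have [/card_setT_F ->|/(cauchy_davenport natF g0 e0)] := eqVneq (sumset (lev g s) (lev e t)) setT.
    exact: geq_minl.
  case: leqP; lia.
rewrite ltnS -sum_n big_mkord.
have -> : (\sum_z n z = \sum_(z in [set: F]) n z)%N by apply: eq_bigl => z; rewrite inE.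
exact: layer_cake_le.
Qed.

End Graph.

(** * The planar case *)

Section Middle.
Variable F : finFieldType.
Hypothesis natF : forall x : F, exists n, x = n%:R.
Variables (m : nat) (I : {set F}).
Hypothesis cF : #|F|.+1 = (3 * m)%N.
Hypothesis cI : #|I| = m.
Hypothesis apI : ap 1 I.
Hypothesis sfI : sumset I I \subset ~: I.

Lemma m_gt0 : (0 < m)%N.
Proof. by case: m cF. Qed.

Lemma I_neq0 : I != set0.
Proof. by rewrite -card_gt0 cI m_gt0. Qed.

Lemma I_neqT : I != setT.
Proof. by apply/eqP => /card_setT_F; rewrite cI; have := m_gt0; lia. Qed.

(** By Cauchy-Davenport [I + I] has at least [2m - 1] elements, as many as the complement of [I], so
    the inclusion [sfI] is an equality. *)
Lemma notin_I x : x \notin I -> exists i j, [/\ i \in I, j \in I & x = i + j].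
Proof.
move=> xI; suff : x \in sumset I I by case/imset2P=> i j iI jI ->; exists i, j.
have -> : sumset I I = ~: I; last by rewrite inE.
apply/eqP; rewrite eqEcard sfI /=; have := card_setC_F I.
have [/card_setT_F ->|/(cauchy_davenport natF I_neq0 I_neq0)] := eqVneq (sumset I I) setT.
  by rewrite card_le_F.
have key a b c q : (q.+1 = 3 * m -> a = m -> a + a <= c.+1 -> a + b = q -> b <= c)%N.
  by clear; lia.
exact: key cF cI.
Qed.

Lemma shift_I_inj s t : shift s I \subset shift t I -> s = t.
Proof.
move=> sub; apply/eqP; rewrite -subr_eq0; apply: contraT => st.
move/negP: I_neqT => []; apply/eqP/(closedT natF st I_neq0) => x xI.
have : x + s \in shift t I by apply: (subsetP sub); rewrite inE addrK.
by rewrite inE addrA.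
Qed.

(** For [m = 1], that is [p = 2], the right-hand side vanishes; this case rests on [D = 0]. *)
Lemma side_condition w D : (2 * D < w)%N -> (m = 1%N -> D = 0%N) ->
  ((2 * m - 1) * D <= m * (m - 1) * w)%N.
Proof.
move=> Dw m1; case: (ltngtP m 1) => [|m2|/m1 ->]; [have := m_gt0; lia | | by rewrite muln0].
have [k ek] : exists k, m = k.+2 by exists (m - 2)%N; lia.
rewrite ek; have -> : (2 * k.+2 - 1 = 2 * k + 3)%N by lia.
have -> : (k.+2 - 1 = k.+1)%N by lia.
apply: (@leq_trans (k.+2 * w)); last by rewrite -mulnA leq_mul2l leq_pmull.
by have : (k.+2 * (2 * D) <= k.+2 * w)%N; [rewrite leq_mul2l ltnW | lia].
Qed.

Variables (w : nat) (al : F -> F -> nat).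
Hypothesis w0 : (0 < w)%N.
Hypothesis alw : forall k x, (al k x <= w)%N.
(** Both inequalities express sum-freeness inside a fibre of size [w]: in [al_sum] a part of [A] is
    disjoint from a part reflected to [c - b], in [al_sub] from a part translated to [a + b]. *)
Hypothesis al_sum : forall k l x y, (0 < al (k + l)%R (x + y)%R)%N -> (al k x + al l y <= w)%N.
Hypothesis al_sub : forall k l x y, (0 < al k x)%N -> (al l y + al (k + l)%R (x + y)%R <= w)%N.

Definition line_total k := (\sum_x al k x)%N.
Definition deficit k := (m * w - line_total k)%N.
Local Notation S k := (supp (al k)).
Local Notation p := #|F|.

Lemma total_supp k : (line_total k <= #|S k| * w)%N.
Proof. by rewrite /line_total sum_supp -sum_nat_const; apply: leq_sum. Qed.

Lemma total_shift k s : S k = shift s I -> line_total k = (\sum_(i in I) al k (s + i)%R)%N.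
Proof.
move=> Sk; rewrite /line_total sum_supp Sk (reindex_inj (addrI s)).
by apply: eq_bigl => i; rewrite inE addrC addKr.
Qed.

Lemma sum_deficit k s : S k = shift s I ->
  (\sum_(i in I) (w - al k (s + i)%R) = deficit k)%N.
Proof.
move=> Sk; rewrite /deficit (total_shift Sk) sumnB; last by move=> i _; apply: alw.
by rewrite sum_nat_const cI.
Qed.

(* The line [g] constrains the pair of lines [k], [k + g], also when [g = 0]. *)
Lemma line_rigid g k s : S g = shift s I ->
  ((2 * m - 1) * deficit g <= m * (m - 1) * w)%N ->
  (deficit g + deficit k < w)%N -> (deficit g + deficit (k + g)%R < w)%N ->
  exists t, S k = shift t I.
Proof.
move=> Sg side dk dkg.
have eD := sum_deficit Sg.
have lt j : (deficit g + deficit j < w)%N -> ((m - 1) * w + deficit g < line_total j)%N.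
  rewrite /deficit -/(deficit g) mulnBl mul1n; have : (w <= m * w)%N by rewrite leq_pmull ?m_gt0.
  by lia.
have bd x i : i \in I -> (0 < al k x)%N -> (0 < al (k + g)%R (x + i + s)%R)%N ->
    (al k x <= w - al g (s + i)%R)%N /\ (al (k + g)%R (x + i + s)%R <= w - al g (s + i)%R)%N.
  move=> iI; have -> : x + i + s = x + (s + i) by rewrite -addrA [i + s]addrC.
  by move=> /(al_sub g (s + i)) h1 /al_sum h2; lia.
have sumb' : (\sum_x al (k + g)%R (x + s)%R = line_total (k + g)%R)%N.
  by rewrite /line_total [RHS](reindex_inj (addIr s)).
have dw i : (w - al g (s + i)%R <= w)%N by apply: leq_subr.
have bw' x : (al (k + g)%R (x + s)%R <= w)%N by [].
have hD : ((2 * m - 1) * (\sum_(i in I) (w - al g (s + i)%R)) <= m * (m - 1) * w)%N by rewrite eD.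
have B1 : ((m - 1) * w + \sum_(i in I) (w - al g (s + i)%R) < \sum_x al k x)%N.
  by rewrite eD; apply: lt.
have B2 : ((m - 1) * w + \sum_(i in I) (w - al g (s + i)%R) < \sum_x al (k + g)%R (x + s)%R)%N.
  by rewrite eD sumb'; apply: lt.
have [c1 _] := rigid_card natF cF cI (alw k) bw' dw bd m_gt0 hD B1 B2.
have [a1 _] := rigid_ap natF cF cI (alw k) bw' dw bd m_gt0 hD B1 B2 apI.
apply: (ap_eq_shift natF (oner_neq0 F) a1 apI); rewrite ?c1 ?cI // -?card_gt0 ?c1 ?m_gt0 //.
by apply/eqP=> /card_setT_F; rewrite c1; have := m_gt0; lia.
Qed.

Hypothesis S0I : S 0 \subset I.
(** Cleared of denominators, this and the next bound say that the line [0] and the whole plane reach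
    the density [m - 1/2 + 1/p], in units of [w] and of [p * w]. *)
Hypothesis big0 : ((2 * m * p + 2) * w <= 2 * p * line_total 0%R + p * w)%N.
Hypothesis big_total : ((2 * m * p + 2) * w <= 2 * \sum_k line_total k + p * w)%N.

Lemma p_gt1 : (1 < p)%N.
Proof. by have := m_gt0; lia. Qed.

Lemma total0_large : (p * (2 * m * w - w) + 2 * w <= p * (2 * line_total 0%R))%N.
Proof.
have := big0; rewrite mulnBr; have : (p * w <= p * (2 * m * w))%N.
  by rewrite leq_mul2l leq_pmull ?orbT // muln_gt0 m_gt0.
have -> : ((2 * m * p + 2) * w = p * (2 * m * w) + 2 * w)%N by ring.
have -> : (2 * p * line_total 0%R = p * (2 * line_total 0%R))%N by ring.
lia.
Qed.

Lemma deficit0_lt : (2 * deficit 0%R < w)%N.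
Proof.
have := total0_large => h; have lt : (2 * m * w - w < 2 * line_total 0%R)%N.
  rewrite -(ltn_pmul2l (ltnW p_gt1)); apply: leq_trans h; lia.
by rewrite /deficit; have : (w <= m * w)%N; [rewrite leq_pmull ?m_gt0 | lia].
Qed.

Lemma S0E : S 0 = shift 0 I.
Proof.
have -> : shift 0 I = I by apply/setP=> x; rewrite inE subr0.
apply/eqP; rewrite eqEcard S0I cI; rewrite leqNgt; apply/negP=> lt.
have := total_supp 0; have : (#|S 0%R| * w <= (m - 1) * w)%N by rewrite leq_mul2r; lia.
by have := deficit0_lt; rewrite /deficit mulnBl mul1n;
   have : (w <= m * w)%N; [rewrite leq_pmull ?m_gt0 | lia].
Qed.

Lemma deficit0_p2 : m = 1%N -> deficit 0%R = 0%N.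
Proof.
move=> m1; have := total0_large; have := cF; rewrite /deficit m1 => e.
have -> : p = 2%N by lia.
lia.
Qed.

Lemma line_rigid0 k : (deficit 0%R + deficit k < w)%N -> exists t, S k = shift t I.
Proof.
move=> dk; apply: (line_rigid S0E); rewrite ?addr0 //.
exact: side_condition deficit0_lt deficit0_p2.
Qed.

(** A line heavier than [m * w] has truncated deficit [0], hence a support of [m] points by
    [line_rigid0], which cannot carry it. So the subtraction in [deficit] is exact. *)
Lemma total_le k : (line_total k <= m * w)%N.
Proof.
rewrite leqNgt; apply/negP=> lt; have dk : deficit k = 0%N by apply/eqP; rewrite subn_eq0 ltnW.
have [|t St] := @line_rigid0 k; first by have := deficit0_lt; rewrite dk; lia.
by move: lt; rewrite ltnNge -cI -(card_shift t) -St total_supp.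
Qed.

Lemma sum_deficits : (2 * (\sum_k deficit k) + 2 * w <= p * w)%N.
Proof.
have : (\sum_k deficit k + \sum_k line_total k = p * (m * w))%N.
  rewrite -big_split /= -sum_nat_const; apply: eq_bigr => k _.
  by rewrite /deficit subnK // total_le.
have := big_total; have -> : ((2 * m * p + 2) * w = 2 * (p * (m * w)) + 2 * w)%N by ring.
lia.
Qed.

Lemma deficit_p2 k : m = 1%N -> deficit k = 0%N.
Proof.
move=> m1; have := sum_deficits; have := cF; rewrite m1 => e; have -> : p = 2%N by lia.
rewrite (bigD1 k) //=; lia.
Qed.

Lemma good_side k : (2 * deficit k < w)%N -> ((2 * m - 1) * deficit k <= m * (m - 1) * w)%N.
Proof. by move=> dk; apply: side_condition => // /deficit_p2. Qed.

Lemma good_interval k : (2 * deficit k < w)%N -> exists t, S k = shift t I.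
Proof. by move=> dk; apply: line_rigid0; have := deficit0_lt; lia. Qed.

(* Large enough to bound the number of extra values of [s_x + s_y] over
   [x + y = q] when the line [q] is not empty, and small enough that
   [weight q * w <= 2 d_q - w] once [d_q >= w]. *)
Definition weight q := maxn 1 (2 * deficit q %/ w - 1).

Lemma weight_le k : (w <= deficit k)%N -> (weight k * w + w <= 2 * deficit k)%N.
Proof.
move=> dk; have h2 : (2 <= 2 * deficit k %/ w)%N.
  by rewrite leq_divRL // leq_mul2l dk orbT.
rewrite /weight (maxn_idPr _); last by lia.
by rewrite -mulSnr subn1 prednK ?leq_divM //; lia.
Qed.

Definition low th : {set F} := [set k | 2 * deficit k < th]%N.
Definition high th : {set F} := [set k | 2 * w - th < 2 * deficit k]%N.

(** If every [th] failed, summing over [th] from 1 to [w] would give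
    [p * w <= 2 * \sum_k deficit k + w], against [sum_deficits]. *)
Lemma ex_threshold : exists th, [/\ (0 < th)%N, (th <= w)%N &
  (\sum_(q in high th) weight q + 2 <= #|low th|)%N].
Proof.
suff /existsP[th h] : [exists th : 'I_w, \sum_(q in high th.+1) weight q + 2 <= #|low th.+1|]%N.
  by exists th.+1; split => //; apply: ltn_ord.
apply: contraT => /existsPn none; have := sum_deficits.
suff : (p * w <= 2 * (\sum_k deficit k) + w)%N by lia.
have L : (\sum_(th < w) #|low th.+1| <= \sum_(th < w) \sum_(q in high th.+1) weight q + w)%N.
  rewrite -[X in (_ <= _ + X)%N]muln1 -[X in (_ <= _ + X * _)%N]card_ord -sum_nat_const -big_split /=.
  by apply: leq_sum => th _; move: (none th); rewrite -ltnNge addn2 addn1 ltnS.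
have eL : (\sum_(th < w) #|low th.+1| = \sum_k (w - 2 * deficit k))%N.
  rewrite (eq_bigr (fun th : 'I_w => \sum_k (2 * deficit k <= th : nat))); last first.
    move=> th _; rewrite -sum1_card [LHS]big_mkcond /=; apply: eq_bigr => k _.
    by rewrite inE ltnS; case: leqP.
  rewrite exchange_big; apply: eq_bigr => k _.
  elim: (w) => [|j IHj]; first by rewrite big_ord0.
  by rewrite big_ord_recr /= IHj; lia.
have eH : (\sum_(th < w) \sum_(q in high th.+1) weight q =
    \sum_k weight k * minn w (2 * deficit k - w))%N.
  rewrite (eq_bigr (fun th : 'I_w => \sum_k weight k * (2 * w - th.+1 < 2 * deficit k)))%N; last first.
    move=> th _; rewrite [LHS]big_mkcond /=; apply: eq_bigr => k _.
    by rewrite inE; case: ltnP; rewrite ?muln1 ?muln0.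
  rewrite exchange_big; apply: eq_bigr => k _ /=; rewrite -big_distrr /=; congr (_ * _)%N.
  (* Reversal of the thresholds turns the condition into [i < 2 * deficit k - w]. *)
  rewrite (reindex_inj rev_ord_inj) minnC -sum_ltn; apply: eq_bigr => i _ /=.
  by have iw := ltn_ord i; congr (nat_of_bool _); apply/idP/idP; lia.
suff : (\sum_(k : F) w + \sum_k weight k * minn w (2 * deficit k - w) <=
    \sum_k (w - 2 * deficit k) + \sum_k 2 * deficit k)%N.
  have key a b X Y : (X <= Y + w -> a + Y <= X + b -> a <= b + w)%N by clear; lia.
  by rewrite sum_nat_const -big_distrr /= -eL -eH; apply: key L.
(* Line by line there is equality if [deficit k < w], and [weight_le] applies otherwise. *)
rewrite -!big_split /=; apply: leq_sum => k _.
have [dk|dk] := ltnP (deficit k) w.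
  have -> : weight k = 1%N.
    apply/maxn_idPl; rewrite leq_subLR addn1 -ltnS ltn_divLR //; lia.
  by lia.
by have := weight_le dk; rewrite (minn_idPl _); lia.
Qed.

(** * Lines of low and of moderate deficit at a fixed threshold *)

Section Threshold.
Variable th : nat.
Hypothesis th0 : (0 < th)%N.
Hypothesis thw : (th <= w)%N.
Hypothesis low_large : (\sum_(q in high th) weight q + 2 <= #|low th|)%N.
Let G := low th.
Let C := high th.
Let E := ~: C.

Let GE : G \subset E.
Proof. by apply/subsetP=> k; rewrite !inE; lia. Qed.

Let cCG : (#|C| + 2 <= #|G|)%N.
Proof.
apply: leq_trans low_large; rewrite leq_add2r -sum1_card.
by apply: leq_sum => q _; apply: leq_maxl.
Qed.

Let cGE : (p.+2 <= #|G| + #|E|)%N.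
Proof. by have := card_setC_F C; rewrite -/E; have := cCG; lia. Qed.

Let deficit_GE x y : x \in G -> y \in E -> (deficit x + deficit y < w)%N.
Proof. by rewrite !inE; lia. Qed.

Let deficit_E y : y \in E -> (deficit y < w)%N.
Proof. by rewrite !inE; lia. Qed.

Let good_G x : x \in G -> (2 * deficit x < w)%N.
Proof. by rewrite inE; lia. Qed.

Let repr_GE q : exists x y, [/\ x \in G, y \in E & q = x + y].
Proof.
have /imset2P[x y xG yE ->] : q \in sumset G E; last by exists x, y.
by rewrite pigeonhole_sumset ?inE //; apply: leq_trans cGE.
Qed.

(** Since [#|G| + #|E| > p], the translate [k + G] meets [E]; a line [x] of [G] with [k + x] in [E]
    makes the line [k] rigid. *)
Lemma interval_E k : k \in E -> exists t, S k = shift t I.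
Proof.
move=> kE; have [x [y [xG yE e]]] : exists x y, [/\ x \in G, y \in E & y = k + x].
  pose G' := shift k G; have : G' :&: E != set0.
    rewrite -card_gt0; have := card_le_F (G' :|: E); have := cardsUI G' E.
    by rewrite /G' card_shift; have := cGE; lia.
  case/set0Pn=> y; rewrite inE [y \in G']inE => /andP[yG yE].
  by exists (y - k), y; rewrite [k + _]addrC subrK.
have [s Ss] := good_interval (good_G xG).
apply: line_rigid Ss (good_side (good_G xG)) _ _; first exact: deficit_GE.
by rewrite -e; apply: deficit_GE.
Qed.

(** The default [0] occurs only at lines whose support is not a translate of [I]. *)
Definition start k := odflt 0 [pick t | S k == shift t I].
Let s := start.

Lemma startP k : k \in E -> S k = shift (s k) I.
Proof.
move=> kE; rewrite /s /start; case: pickP => [t /eqP //|no].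
by have [t St] := interval_E kE; have := no t; rewrite St eqxx.
Qed.

Lemma al_E k i : k \in E -> i \in I -> (w - al k (s k + i)%R <= deficit k)%N.
Proof. by move=> kE iI; rewrite -(sum_deficit (startP kE)) (bigD1 i) //= leq_addr. Qed.

(** Otherwise the offset is [i + j] with [i], [j] in [I]. Then [al_sum] bounds by [w] the sum of two
    fibre sizes that together fall short of [2w] by less than [w]. *)
Lemma supp_add x y z : x \in G -> y \in E -> z \in S (x + y) -> z - (s x + s y) \in I.
Proof.
move=> xG yE; rewrite inE => z0; apply: contraT => /notin_I[i [j [iI jI e]]].
have := deficit_GE xG yE; have := al_E (subsetP GE _ xG) iI; have := al_E yE jI.
have : (al x (s x + i)%R + al y (s y + j)%R <= w)%N.
  by apply: al_sum; have -> : s x + i + (s y + j) = z by rewrite addrACA -e addrC subrK.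
move: (alw x (s x + i)) (alw y (s y + j)); lia.
Qed.

Lemma start_add x y : x \in G -> y \in E -> x + y \in E -> s (x + y) = s x + s y.
Proof.
move=> xG yE xyE; apply: shift_I_inj; apply/subsetP=> z; rewrite -startP // => zS.
by rewrite inE supp_add.
Qed.

Section Sheared.
Variable c : F.
Let f x := s x - c * x.

Definition values q : {set F} := [set z.2 | z in [set z in graph_sum G E f | z.1 == q]].

Lemma card_values q : #|[set z in graph_sum G E f | z.1 == q]| = #|values q|.
Proof.
rewrite card_in_imset // => -[a b] [a' b']; rewrite !inE /= => /andP[_ /eqP ->].
by move=> /andP[_ /eqP ->] ->.
Qed.

(** The difference set of [S q] and [values q] fits into a translate of [I], so
    [#|S q| + #|values q| <= m + 1] by Cauchy-Davenport. *)
Lemma values_deficit q : S q != set0 -> (#|values q| * w <= deficit q + w)%N.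
Proof.
move=> S0; have [->|V0] := eqVneq (values q) set0; first by rewrite cards0.
have sub : sumset (S q) (oppset (values q)) \subset shift (c * q) I.
  apply/subsetP=> _ /imset2P[z v zS + ->]; rewrite !inE => /imsetP[[a b]].
  rewrite inE /= => /andP[/imset2P[x y xG yE [ea eb]] /eqP aq] vb.
  have := supp_add xG yE (z := z); rewrite -ea aq => /(_ zS).
  have -> // : z - (s x + s y) = z + v - c * q.
  by rewrite -[v]opprK vb eb -aq ea /f; ring.
have V0' : oppset (values q) != set0 by rewrite -card_gt0 card_oppset card_gt0.
have nT : sumset (S q) (oppset (values q)) != setT.
  apply/eqP=> /card_setT_F e; have := subset_leq_card sub.
  by rewrite card_shift cI e; have := m_gt0; lia.
have h := cauchy_davenport natF S0 V0' nT.
have h' : (#|S q| + #|values q| <= m.+1)%N.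
  rewrite -(card_oppset (values q)); apply: leq_trans h _.
  by rewrite ltnS; have := subset_leq_card sub; rewrite card_shift cI.
have := total_supp q; have := total_le q; rewrite /deficit.
have : ((#|S q| + #|values q|) * w <= m.+1 * w)%N by rewrite leq_mul2r h' orbT.
by rewrite mulnDl mulSn; lia.
Qed.

Lemma values_E q : q \in E -> (#|values q| <= 1)%N.
Proof.
move=> qE; have S0 : S q != set0.
  by rewrite (startP qE) -card_gt0 card_shift cI m_gt0.
have := values_deficit S0; have := deficit_E qE => h1 h2.
by rewrite -ltnS -(ltn_pmul2r w0); lia.
Qed.

Lemma values_weight q : S q != set0 -> (#|values q| <= weight q + 1)%N.
Proof.
move=> S0; have h := values_deficit S0.
case: (leqP #|values q| 2) => [r2|r3]; first by apply: leq_trans r2 _; rewrite addn1 ltnS leq_maxl.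
have [k ek] : exists k, #|values q| = k.+3 by exists (#|values q| - 3)%N; lia.
rewrite /weight ek addn1 ltnS leq_max; apply/orP; right.
rewrite leq_subRL; last by rewrite leq_divRL //; move: h; rewrite ek; nia.
by rewrite leq_divRL //; move: h; rewrite ek; nia.
Qed.

(** A line of [E] carries at most one value, a line [q] of [C] at most [weight q + 1], and the
    threshold keeps the sum of these weights at most [#|G| - 2]. The result is one below the bound
    of [card_graph_sum]. *)
Lemma graph_sum_small : (forall q, S q != set0) -> (#|graph_sum G E f| + 2 <= p + #|G|)%N.
Proof.
move=> S0; rewrite -(sum_card_fibres (graph_sum G E f) fst).
have -> : (\sum_u #|[set x in graph_sum G E f | x.1 == u]| = \sum_u #|values u|)%N.
  by apply: eq_bigr => u _; apply: card_values.
have -> : (\sum_u #|values u| = \sum_(u in C) #|values u| + \sum_(u in E) #|values u|)%N.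
  by rewrite (bigID (mem C)) /=; congr (_ + _)%N; apply: eq_bigl => u; rewrite [u \in E]in_setC.
have h1 : (\sum_(u in C) #|values u| <= \sum_(u in C) weight u + #|C|)%N.
  by rewrite -sum1_card -big_split /=; apply: leq_sum => u _; apply: values_weight.
have h2 : (\sum_(u in E) #|values u| <= #|E|)%N.
  by rewrite -sum1_card; apply: leq_sum => u; apply: values_E.
have := card_setC_F C; rewrite -/E; have := low_large; rewrite -/G -/C; lia.
Qed.

Lemma sheared_const x1 x2 y : (forall q, S q != set0) ->
  x1 \in G -> x2 \in G -> x1 != x2 -> f x1 = f x2 -> y \in G -> f y = f x1.
Proof.
move=> S0 x1G x2G x12 fx yG; apply/eqP; apply: contraT => fy.
have := card_graph_sum natF GE cGE x1G x2G yG x12 fx fy.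
have := graph_sum_small S0; lia.
Qed.

End Sheared.

Lemma collinear_nonempty : (forall q, S q != set0) ->
  exists c v : F, forall x, x \in G -> s x = c * x + v.
Proof.
move=> S0; have /card_gt1P[x1 [x2 [x1G x2G x12]]] : (1 < #|G|)%N by have := cCG; lia.
pose c := (s x1 - s x2) / (x1 - x2).
have x0 : x1 - x2 != 0 by rewrite subr_eq0.
exists c, (s x1 - c * x1) => x xG.
have := @sheared_const c x1 x2 x S0 x1G x2G x12 _ xG => <-; first by ring.
apply/eqP; rewrite subr_eq -subr_eq0; apply/eqP.
have -> : s x1 - (s x2 - c * x2 + c * x1) = (s x1 - s x2) - c * (x1 - x2) by ring.
by rewrite /c divfK // subrr.
Qed.

(** Union bound: the condition for a pair [(t, X)] excludes a translate of the complement of [X]. *)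
Lemma avoid_shifts (L : seq (F * {set F})) : (\sum_(q <- L) #|~: q.2| < p)%N ->
  exists z, all (fun q : F * {set F} => (z + q.1)%R \in q.2) L.
Proof.
move=> lt; apply/existsP; move: lt; apply: contraLR; rewrite -leqNgt => /existsPn none.
suff : setT \subset \bigcup_(q <- L) shift (- q.1) (~: q.2).
  move/subset_leq_card; rewrite cardsT => /leq_trans; apply.
  elim: L {none} => [|q L IHL]; first by rewrite !big_nil cards0.
  rewrite !big_cons; apply: leq_trans (leq_card_setU _ _) _.
  by rewrite card_shift leq_add2l.
apply/subsetP=> z _; have := none z; rewrite -has_predC.
elim: L {none} => [//|q L IHL] /=; rewrite big_cons !inE opprK.
by case: (_ \in _) => //= /IHL.
Qed.

(* An empty line carries deficit [m w], so [G] is so large that the differences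
   of [s] on [G] depend only on the differences of the indices. *)
Lemma collinear_empty q0 : S q0 = set0 ->
  exists c v : F, forall x, x \in G -> s x = c * x + v.
Proof.
move=> Sq0; have m0 := m_gt0.
have d0 : deficit q0 = (m * w)%N.
  by have := total_supp q0; rewrite Sq0 cards0 mul0n leqn0 /deficit => /eqP ->; rewrite subn0.
have q0C : q0 \in C by rewrite inE d0; have : (w <= m * w)%N; [rewrite leq_pmull | lia].
have cCG2 : (#|C| + 2 * m <= #|G|)%N.
  apply: leq_trans low_large; rewrite -/C (bigD1 q0) //= [#|C|](cardsD1 q0) q0C.
  (* The line [q0] alone weighs [2m - 1], so [low_large] gains [2m - 2] over the count of [C]. *)
  have -> : weight q0 = maxn 1 (2 * m - 1) by rewrite /weight d0 mulnA mulnK.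
  have : (#|C :\ q0| <= \sum_(i in C | i != q0) weight i)%N.
    rewrite -sum1_card (eq_bigl (fun i => (i \in C) && (i != q0))); last first.
      by move=> i; rewrite !inE andbC.
    by apply: leq_sum => i _; apply: leq_maxl.
  move: (\sum_(i in C | i != q0) weight i)%N => X; lia.
have cGC := card_setC_F G; have cEC : #|~: E| = #|C| by rewrite setCK.
(* Let [d = a - b]. With [z], [z + d] in [G] and [a + z], [a' + z] in [E], additivity of [s] at
   [a + z = b + (z + d)], and likewise for [a'], makes both differences equal to
   [s (z + d) - s z]. *)
have well a b a' b' : a \in G -> b \in G -> a' \in G -> b' \in G -> a - b = a' - b' ->
    s a - s b = s a' - s b'.
  have key (d : F) (x y z : F) : x \in G -> y \in G -> z \in G -> z + d \in G ->
      x - y = d -> x + z \in E -> s x - s y = s (z + d) - s z.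
    move=> xG yG zG zdG ed xzE.
    have e1 := start_add xG (subsetP GE _ zG) xzE.
    have exz : x + z = y + (z + d) by rewrite -ed; ring.
    have e2 := start_add yG (subsetP GE _ zdG); rewrite -exz in e2.
    have e3 := e2 xzE; rewrite e1 in e3; apply/eqP; rewrite subr_eq.
    have -> : s (z + d) - s z + s y = (s y + s (z + d)) - s z by ring.
    by rewrite -e3 addrK.
  move=> aG bG a'G b'G e.
  have [|z /= /and5P[zG zdG zaE za'E _]] :=
      @avoid_shifts [:: (0, G); (a - b, G); (a, E); (a', E)].
    rewrite !big_cons big_nil /= cEC.
    (* At most [2(p - #|G|) + 2#|C| <= 2p - 4m] values of [z] are excluded, fewer than
       [p = 3m - 1]. *)
    have few q g gc k : (q.+1 = 3 * m -> g + gc = q -> k + 2 * m <= g ->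
      gc + (gc + (k + (k + 0))) < q)%N by move: m0; clear; lia.
    exact: few cF cGC cCG2.
  rewrite addr0 in zG.
  rewrite (key (a - b) a b z) ?[a + z]addrC //.
  by rewrite (key (a - b) a' b' z) ?[a' + z]addrC.
have few2 q g gc k : (q.+1 = 3 * m -> g + gc = q -> k + 2 * m <= g -> gc + (gc + 0) < q)%N.
  by move: m0; clear; lia.
have few3 q g gc k : (q.+1 = 3 * m -> g + gc = q -> k + 2 * m <= g ->
    gc + (gc + (gc + 0)) < q)%N.
  by move: m0; clear; lia.
have [|b1 /= /and3P[b1G b11G _]] := @avoid_shifts [:: (0, G); (1, G)].
  by rewrite !big_cons big_nil /=; exact: few2 cF cGC cCG2.
rewrite addr0 in b1G.
pose c := s (b1 + 1) - s b1.
have lin n : forall a b, a \in G -> b \in G -> a - b = n%:R -> s a - s b = c * n%:R.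
  elim: n => [|n IHn] a b aG bG eab.
    by move/eqP: eab; rewrite subr_eq0 => /eqP ->; rewrite subrr mulr0.
  (* The point [z + n] splits a difference [n + 1] into differences [n] and 1 between elements of
     [G]. *)
  have [|z /= /and4P[zG znG zn1G _]] := @avoid_shifts [:: (0, G); (n%:R, G); (n.+1%:R, G)].
    by rewrite !big_cons big_nil /=; exact: few3 cF cGC cCG2.
  rewrite addr0 in zG.
  rewrite (well a b (z + n.+1%:R) z) //; last by rewrite eab; ring.
  have h1 : s (z + n%:R) - s z = c * n%:R by apply: IHn => //; ring.
  have h2 : s (z + n.+1%:R) - s (z + n%:R) = c by apply: well => //; rewrite -natr1; ring.
  have -> : s (z + n.+1%:R) - s z =
     (s (z + n.+1%:R) - s (z + n%:R)) + (s (z + n%:R) - s z) by ring.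
  by rewrite h1 h2 -natr1; ring.
exists c, (s b1 - c * b1) => x xG.
have [n en] := natF (x - b1); have := lin n x b1 xG b1G en.
by rewrite -en => /eqP; rewrite subr_eq => /eqP ->; ring.
Qed.

Lemma collinear : exists c v : F, forall x, x \in G -> s x = c * x + v.
Proof.
have [/existsP[q0 /eqP /collinear_empty //]|/existsPn S0] := boolP [exists q, S q == set0].
exact: collinear_nonempty.
Qed.

(* On a class of [E] where [s k - c k] is constant, adding [G] would leave the
   class by fewer than [|G| - 1] elements, against Cauchy-Davenport. *)
Lemma start_linear : exists c : F, forall k, k \in E -> s k = c * k.
Proof.
have [c [v sG]] := collinear; exists c.
pose f k := s k - c * k; pose cl (u : F) : {set F} := [set k in E | f k == u].
have fG x : x \in G -> f x = v by move=> xG; rewrite /f sG //; ring.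
have [g gG] : exists g, g \in G by apply/set0Pn; rewrite -card_gt0; have := cCG; lia.
have gE := subsetP GE _ gG.
have G0 : G != set0 by apply/set0Pn; exists g.
have cl_v : cl v != set0 by apply/set0Pn; exists g; rewrite inE gE fG ?eqxx.
have [u clu umax] : exists2 u : F, cl u != set0 &
    forall u' : F, cl u' != set0 -> (#|cl u'| <= #|cl u|)%N.
  by case: (@arg_maxnP F v (fun u => cl u != set0) (fun u => #|cl u|) cl_v) => u clu umax; exists u.
have sub : sumset G (cl u) \subset cl (u + v) :|: C.
  apply/subsetP=> _ /imset2P[x y xG yc ->].
  have [yE fy] : y \in E /\ f y = u by move: yc; rewrite inE => /andP[? /eqP].
  rewrite in_setU; have [xyC|xyC] := boolP (x + y \in C); first by rewrite orbT.
  have xyE : x + y \in E by rewrite in_setC.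
  rewrite orbF [_ \in cl _]inE xyE /=.
  have fx := fG _ xG; rewrite /f (start_add xG yE xyE) -fy -fx /f; apply/eqP; ring.
(* If the sumset is everything, [E] is a single class, whose value is at once [u], [v] and [u + v],
   hence [0]. *)
have [sT|nT] := eqVneq (sumset G (cl u)) setT.
  have all_uv k : k \in E -> f k = u + v.
    move=> kE; have : k \in cl (u + v) :|: C by apply: (subsetP sub); rewrite sT inE.
    by move: kE; rewrite !inE => /negbTE ->; rewrite orbF => /andP[_ /eqP].
  case/set0Pn: clu => y; rewrite inE => /andP[yE /eqP fy].
  have v0 : v = 0 by apply: (addrI u); rewrite addr0 -(all_uv y yE).
  have u0 : u = 0 by move: (all_uv g gE); rewrite fG // v0 addr0.
  by move=> k kE; have := all_uv k kE; rewrite u0 v0 addr0 /f => /eqP; rewrite subr_eq0 => /eqP.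
have le_u : (#|cl (u + v)%R| <= #|cl u|)%N.
  by have [->|n0] := eqVneq (cl (u + v)) set0; [rewrite cards0 | exact: umax].
have key g' k a b e t : (k + 2 <= g' -> b <= a -> t <= b + k -> e <= t -> g' + a <= e.+1 -> False)%N.
  by clear; lia.
have [lU _] := leq_card_setU (cl (u + v)) C.
by case: (key _ _ _ _ _ _ cCG le_u lU (subset_leq_card sub) (cauchy_davenport natF G0 clu nT)).
Qed.

Lemma plane_threshold : exists c : F, forall k x, (0 < al k x)%N -> x - c * k \in I.
Proof.
have [c sE] := start_linear; exists c => q z z0.
have [x [y [xG yE eq]]] := repr_GE q.
have := @supp_add x y z xG yE; rewrite -eq inE => /(_ z0).
by rewrite (sE _ yE) (sE _ (subsetP GE _ xG)) -mulrDr -eq.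
Qed.

End Threshold.

Lemma plane : exists c : F, forall k x, (0 < al k x)%N -> x - c * k \in I.
Proof. by have [th [th0 thw h]] := ex_threshold; apply: plane_threshold h. Qed.

End Middle.

(** * Functionals and the induction on the dimension *)

Definition middle (F : finFieldType) m : {set F} := [set (m + j)%:R | j : 'I_m].

(** * Sum-free sets in dimension one *)

Section MiddleThird.
Variable F : finFieldType.
Hypothesis natF : forall x : F, exists n, x = n%:R.
Variable m : nat.
Hypothesis cF : #|F|.+1 = (3 * m)%N.
Local Notation I := (middle F m).

Lemma natr_F_inj i j : (i < #|F|)%N -> (j < #|F|)%N -> i%:R = j%:R :> F -> i = j.
Proof. by move=> iF jF; apply: (mulrn_inj natF (oner_neq0 F)). Qed.

Lemma card_middle : #|I| = m.
Proof.
rewrite card_imset ?card_ord // => i j /natr_F_inj h; apply/val_inj/(@addnI m)/h.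
  by have := ltn_ord i; lia.
by have := ltn_ord j; lia.
Qed.

Lemma ap_middle : ap 1 I.
Proof.
apply: (@leq_trans #|[set (2 * m - 1)%:R : F]|); last by rewrite cards1.
apply/subset_leq_card/subsetP=> x; rewrite !inE => /andP[/imsetP[j _ ->] nj].
apply/eqP; congr _%:R; have jm := ltn_ord j.
apply/eqP; apply: contraR nj => ne; have j1 : (j.+1 < m)%N by lia.
by apply/imsetP; exists (Ordinal j1) => //=; rewrite natr1 addnS.
Qed.

Lemma middle_sum_free : sumset I I \subset ~: I.
Proof.
apply/subsetP=> _ /imset2P[_ _ /imsetP[i _ ->] /imsetP[j _ ->] ->]; rewrite inE.
apply/negP=> /imsetP[k _]; rewrite -natrD -addnA !natrD => /addrI; rewrite -!natrD.
have := ltn_ord i; have := ltn_ord j; have := ltn_ord k => km jm im.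
by move/natr_F_inj => h; have := h _ _; lia.
Qed.

Lemma zero_notin_middle : 0 \notin I.
Proof.
apply/negP=> /imsetP[j _ /esym]; have jm := ltn_ord j.
by move/(@natr_F_inj _ 0%N) => h; have := h _ _; lia.
Qed.

(** [A + A] avoids [A], so Cauchy-Davenport gives [#|A| = m], and for [m > 1] Vosper's theorem gives
    a difference [d]. Then [A / d] is a translate of [I], and sum-freeness excludes a nonzero
    translation. *)
Lemma sum_free_dilate (A : {set F}) : sum_free A -> (m <= #|A|)%N ->
  exists c, forall a, a \in A -> c * a \in I.
Proof.
move=> sfA mA; have m0 : (0 < m)%N by lia.
have A0 : A != set0 by rewrite -card_gt0; lia.
have sub : sumset A A \subset ~: A.
  apply/subsetP=> _ /imset2P[a b aA bA ->]; rewrite inE; apply/negP => abA.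
  exact: sfA aA bA abA erefl.
have := cauchy_davenport_setC natF A0 A0 A0 sub => h.
have cA : #|A| = m by lia.
case: (leqP m 1) => [m1|m1].
  have /cards1P[a eA] : #|A| == 1%N by rewrite cA; lia.
  have a0 : a != 0.
    apply/eqP=> a0; have aA : a \in A by rewrite eA set11.
    by apply: (sfA _ _ _ aA aA aA); rewrite a0 addr0.
  exists a^-1 => b; rewrite eA inE => /eqP ->; rewrite mulVf //.
  by apply/imsetP; exists (Ordinal m0) => //=; have -> : (m + 0 = 1)%N by lia.
have := subset_leq_card sub; have := card_setC_F A; rewrite cA => e1 e2.
have [||||d d0 [apA _]] := vosper natF (A := A) (B := A); rewrite ?cA; try by lia.
pose A' := [set x | x * d \in A].
have card_pre (X : {set F}) : #|[set x | x * d \in X]| = #|X|.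
  rewrite -(card_imset [set x | x * d \in X] (mulIf d0)); apply: eq_card => x.
  apply/imsetP/idP => [[y + ->]|xX]; first by rewrite inE.
  by exists (x / d); rewrite ?inE divfK.
have cA' : #|A'| = m by rewrite card_pre.
have apA' : ap 1 A'.
  rewrite /ap -(card_pre (ends d A)) in apA *; apply: leq_trans apA.
  by apply/subset_leq_card/subsetP=> x; rewrite !inE mulrDl mul1r.
have A'0 : A' != set0 by rewrite -card_gt0 cA'.
have A'T : A' != setT by apply/eqP=> /card_setT_F; rewrite cA'; lia.
have cAm : #|A'| = #|I| by rewrite cA' card_middle.
have [t A't] := ap_eq_shift natF (oner_neq0 F) apA' ap_middle cAm A'0 A'T.
exists d^-1 => a aA.
have : a / d \in A' by rewrite inE divfK.
rewrite A't inE; suff -> : t = 0 by rewrite subr0 mulrC.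
apply/eqP/negPn/negP; rewrite -oppr_eq0 => t0.
have neT : I != setT := I_neqT cF card_middle ap_middle middle_sum_free; case/negP: neT; apply/eqP.
(* If [t] is nonzero, some [k] in [I] has [k - t] outside [I], hence equal to some [i + j]; then
   [(i + t) + (j + t) = k + t]. *)
apply: (closedT natF t0 (I_neq0 cF card_middle)) => k kI; apply: contraT => nk.
have [i [j [iI jI e]]] := notin_I natF cF card_middle middle_sum_free nk.
have inA x : x \in I -> (x + t) * d \in A.
  move=> xI; have : x + t \in A'; first by rewrite A't inE addrK.
  by rewrite inE.
case: (sfA _ _ _ (inA _ iI) (inA _ jI) (inA _ kI)).
have -> : k = i + j + t by rewrite -e subrK.
by ring.
Qed.

End MiddleThird.

(** * Averaging over hyperplanes *)

Section FibreCount.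
Variables (V : finZmodType) (W : finType) (f : V -> W).

Lemma card_fibre : (forall x y, exists t, forall v, f v = x -> f (v + t) = y) ->
  forall x, (#|W| * #|[set v | f v == x]| = #|V|)%N.
Proof.
move=> trans x; have le y z : (#|[set v | f v == y]| <= #|[set v | f v == z]|)%N.
  have [t ft] := trans y z; rewrite -(card_imset [set v | f v == y] (addIr t)).
  apply/subset_leq_card/subsetP=> _ /imsetP[v + ->].
  by rewrite !inE => /eqP /ft ->.
rewrite -[RHS]cardsT -(sum_card_fibres [set: V] f) -sum_nat_const.
apply: eq_bigr => y _; apply/eqP; rewrite eqn_leq; apply/andP; split.
  by apply: leq_trans (le x y) _; apply/subset_leq_card/subsetP=> v; rewrite !inE.
by apply: leq_trans (le y x); apply/subset_leq_card/subsetP=> v; rewrite !inE.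
Qed.

End FibreCount.

Section SectionArithmetic.
Local Open Scope nat_scope.

(** Here [A] is the size of the set, [Z] the number of nonzero functionals and [S] the sum of the
    sizes of the sections by their kernels, each at most [k = m - 1] if all fail. *)
Lemma plane_section_arith k A S Z : let m := k.+1 in let p := 3 * k + 2 in
  S + A = A * p -> Z.+1 = p * p -> S <= Z * k -> 2 * m * p + 2 <= 2 * A + p -> False.
Proof.
move=> m p SA Zp SZ LA.
have eZ : Z = (3 * k + 1) * (3 * k + 3) by apply: succn_inj; rewrite Zp /p; ring.
have eS : S = A * (3 * k + 1).
  by apply/eqP; rewrite -(eqn_add2r A) SA /p; apply/eqP; ring.
have : A <= (3 * k + 3) * k.
  rewrite -(leq_pmul2r (ltn0Sn (3 * k))) -addn1 -eS; apply: leq_trans SZ _.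
  by rewrite eZ; apply/eq_leq; ring.
move: LA; rewrite /m /p.
have -> : 2 * k.+1 * (3 * k + 2) + 2 = 2 * ((3 * k + 3) * k) + 4 * k + 6 by ring.
lia.
Qed.

(** The analogous count in higher dimension, where [p * q] is the fibre size [p ^ n]; the summand 1
    beside [p * q] comes from integrality. *)
Lemma section_arith k r A S Z : let m := k.+1 in let p := 3 * k + 2 in let q := r.+1 in
  let K := 2 * m * p + 2 in
  S + A = A * (p * (p * q)) -> Z.+1 = p * (p * (p * q)) ->
  2 * S + Z * (p * q + 1) <= Z * (K * q) -> K * (p * q) <= 2 * A + p * (p * q) -> False.
Proof.
move=> m p q K SA Zp SZ LA.
pose C := p * p * r + (9 * k * k + 12 * k + 3).
have eZ : Z = p * p * p * r + (27 * k * k * k + 54 * k * k + 36 * k + 7).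
  by apply: succn_inj; rewrite Zp /p /q; ring.
have eS : S = A * C.
  by apply/eqP; rewrite -(eqn_add2r A) SA /p /C /q /p; apply/eqP; ring.
have LAC : K * (p * q) * C <= 2 * S + p * (p * q) * C.
  have : K * (p * q) * C <= (2 * A + p * (p * q)) * C by rewrite leq_mul2r LA orbT.
  by rewrite mulnDl -[2 * A * C]mulnA -eS.
have id : K * (p * q) * C + Z * (p * q + 1) + 1 =
    Z * (K * q) + p * (p * q) * C + q * (9 * k * k * k + 27 * k * k + 17 * k + 4).
  by rewrite eZ /C /K /m /p /q; ring.
have : 4 <= q * (9 * k * k * k + 27 * k * k + 17 * k + 4).
  by rewrite /q mulSn; apply: leq_trans (leq_addr _ _); apply: leq_addl.
lia.
Qed.

End SectionArithmetic.

Section Functionals.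
Variable F : finFieldType.
Hypothesis natF : forall x : F, exists n, x = n%:R.
Variable m : nat.
Hypothesis cF : #|F|.+1 = (3 * m)%N.
Local Notation I := (middle F m).
Local Notation p := #|F|.

Definition app n (phi : 'cV[F]_n) (a : 'rV[F]_n) : F := (a *m phi) 0 0.

Lemma appD n (phi : 'cV[F]_n) a b : app phi (a + b) = app phi a + app phi b.
Proof. by rewrite /app mulmxDl mxE. Qed.

Lemma appB n (phi : 'cV[F]_n) a b : app phi (a - b) = app phi a - app phi b.
Proof. by rewrite /app mulmxBl !mxE. Qed.

Lemma appZ n (phi : 'cV[F]_n) c a : app phi (c *: a) = c * app phi a.
Proof. by rewrite /app -scalemxAl mxE. Qed.

Lemma appDr n (phi psi : 'cV[F]_n) a : app (phi + psi) a = app phi a + app psi a.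
Proof. by rewrite /app mulmxDr mxE. Qed.

Lemma appZr n (phi : 'cV[F]_n) c a : app (c *: phi) a = c * app phi a.
Proof. by rewrite /app -scalemxAr mxE. Qed.

Lemma app_eq0 n (phi : 'cV[F]_n) a : (app phi a == 0) = (a *m phi == 0).
Proof.
apply/eqP/eqP=> [h|]; last by rewrite /app => ->; rewrite mxE.
by apply/matrixP=> i j; rewrite !ord1 [RHS]mxE.
Qed.

Lemma app_neq0 n (phi : 'cV[F]_n) : phi != 0 -> exists a, app phi a != 0.
Proof.
move=> phi0; apply/existsP; apply: contraR phi0 => /existsPn h.
apply/eqP/matrixP=> i j; rewrite ord1 mxE; have := h (delta_mx 0 i).
by rewrite negbK /app -rowE mxE => /eqP.
Qed.

Lemma card_annihilator n (a : 'rV[F]_n) : a != 0 ->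
  (p * #|[set phi : 'cV[F]_n | app phi a == 0%R]| = p ^ n)%N.
Proof.
move=> a0; have -> : (p ^ n = #|'cV[F]_n|)%N by rewrite card_mx muln1.
have [phi1 h1] : exists phi1 : 'cV[F]_n, app phi1 a != 0.
  have [|b hb] := @app_neq0 n a^T; first by rewrite trmx_eq0.
  by exists b^T; rewrite /app -[a]trmxK -trmx_mul mxE.
apply: (@card_fibre 'cV[F]_n F (fun phi => app phi a)) => x y.
exists (((y - x) / app phi1 a) *: phi1) => phi <-.
by rewrite appDr appZr divfK // addrC subrK.
Qed.

Lemma card_fibre2 n (psi phi : 'cV[F]_n.+2) (u v : 'rV[F]_n.+2) x :
  app psi u != 0 -> app psi v = 0 -> app phi v != 0 ->
  #|[set a | (app psi a, app phi a) == x]| = (p ^ n)%N.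
Proof.
move=> u0 v0 v1.
have : (#|{: F * F}| * #|[set a | (app psi a, app phi a) == x]| = #|'rV[F]_n.+2|)%N.
  apply: (@card_fibre 'rV[F]_n.+2 (F * F)%type (fun a => (app psi a, app phi a))) => -[x1 x2] [y1 y2].
  pose c := (y1 - x1) / app psi u.
  exists (c *: u + ((y2 - x2 - c * app phi u) / app phi v) *: v) => a [e1 e2].
  by rewrite !appD !appZ v0 e1 e2 /c; congr (_, _); field; rewrite ?u0 ?v1.
rewrite card_prod card_mx mul1n !expnS mulnA => /eqP.
by rewrite eqn_pmul2l ?muln_gt0 ?andbb; [move/eqP | rewrite -ltnS cF; lia].
Qed.

Section Hyperplane.
Variables (n : nat) (A : {set 'rV[F]_n.+2}).
Hypothesis sfA : sum_free A.
Let K := (2 * m * p + 2)%N.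
Hypothesis largeA : (K * p ^ n.+1 <= 2 * p * #|A| + p * p ^ n.+1)%N.

Let m0 : (0 < m)%N. Proof. by case: m cF. Qed.
Let p0 : (0 < p)%N. Proof. by have := cF; lia. Qed.

Lemma sum_free_neq0 a : a \in A -> a != 0.
Proof. by move=> aA; apply/eqP=> a0; apply: (sfA aA aA aA); rewrite a0 addr0. Qed.

Let largeA' : (K * p ^ n <= 2 * #|A| + p * p ^ n)%N.
Proof.
rewrite -(leq_pmul2l p0); apply: leq_trans (leq_trans _ largeA) _; rewrite !expnS.
  by rewrite mulnCA.
by rewrite mulnDr leq_add // ?leqnn //; lia.
Qed.

(** Each element of [A], being nonzero, is annihilated by the fraction [1/p] of all functionals. If
    every nonzero functional failed the bound, the sections would be too small on average. *)
Lemma ex_large_section : exists2 psi : 'cV[F]_n.+2, psi != 0 &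
  (K * p ^ n <= 2 * p * #|[set a in A | app psi a == 0%R]| + p * p ^ n)%N.
Proof.
suff /existsP[psi /andP[psi0 h]] : [exists psi : 'cV[F]_n.+2, (psi != 0) &&
  (K * p ^ n <= 2 * p * #|[set a in A | app psi a == 0%R]| + p * p ^ n)%N] by exists psi.
apply: contraT => /existsPn none.
pose N (psi : 'cV[F]_n.+2) := #|[set a in A | app psi a == 0]|.
pose Z := [set psi : 'cV[F]_n.+2 | psi != 0].
have cZ : (#|Z|.+1 = p ^ n.+2)%N.
  have -> : (p ^ n.+2 = #|'cV[F]_n.+2|)%N by rewrite card_mx muln1.
  have -> : Z = [set~ 0] by apply/setP=> psi; rewrite !inE.
  by rewrite cardsC1 prednK // (cardD1 (0 : 'cV[F]_n.+2)).
have sumN : (\sum_(psi in Z) N psi + #|A| = #|A| * p ^ n.+1)%N.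
  rewrite (eq_bigr (fun psi => \sum_(a in A) (app psi a == 0)%R)%N); last first.
    move=> psi _; rewrite /N -sum1_card [LHS]big_mkcond [RHS]big_mkcond /=.
    by apply: eq_bigr => a _; rewrite inE; case: (a \in A); case: (_ == _).
  rewrite exchange_big /= -[X in (_ + X)%N]sum1_card -big_split /= -sum_nat_const.
  apply: eq_bigr => a aA; have := card_annihilator (sum_free_neq0 aA).
  rewrite expnS => /eqP; rewrite eqn_pmul2l // => /eqP <-.
  have h0 : app (0 : 'cV[F]_n.+2) a = 0 by rewrite /app mulmx0 mxE.
  rewrite (cardsD1 (0 : 'cV[F]_n.+2)) inE h0 eqxx addnC; congr (_ + _)%N.
  rewrite -sum1_card [LHS]big_mkcond [RHS]big_mkcond /=; apply: eq_bigr => psi _.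
  by rewrite !inE; case: (psi == 0) => //=; case: (_ == _).
have small psi : psi \in Z -> (2 * p * N psi + p * p ^ n < K * p ^ n)%N.
  by rewrite inE => psi0; have := none psi; rewrite psi0 /= -ltnNge.
have [k [ek ep]] : exists k, m = k.+1 /\ p = (3 * k + 2)%N.
  by exists m.-1; have := cF; have := m0; lia.
have leS c : (forall psi, psi \in Z -> N psi <= c)%N -> (\sum_(psi in Z) N psi <= #|Z| * c)%N.
  by move=> h; rewrite -sum_nat_const; apply: leq_sum.
exfalso; have LA := largeA'.
(* Sizes are integers: in the plane a failing section has at most [m - 1] points; otherwise [p]
   divides both sides of the strict inequality, which gains 1 after division. *)
have [en|[r en]] : (p ^ n = 1 \/ exists r, p ^ n = p * r.+1)%N.
  case: (n) => [|n']; first by left.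
  by right; exists (p ^ n').-1; rewrite prednK ?expnS // expn_gt0 p0.
- rewrite !expnS en !muln1 in cZ sumN LA.
  have small2 psi : psi \in Z -> (N psi <= k)%N.
    move=> /small; rewrite en !muln1 /K => lt; rewrite leqNgt; apply/negP=> le.
    have : (2 * p * m <= 2 * p * N psi)%N by rewrite leq_mul2l ek le orbT.
    have : (2 * p * m = 2 * m * p)%N by ring.
    by have := cF; have := m0; lia.
  apply: (@plane_section_arith k #|A| (\sum_(psi in Z) N psi) #|Z|); rewrite -?ek -?ep //.
  exact: leS.
rewrite !expnS en in cZ sumN LA.
apply: (@section_arith k r #|A| (\sum_(psi in Z) N psi) #|Z|); rewrite -?ek -?ep //.
suff : (\sum_(psi in Z) (2 * N psi + (p * r.+1 + 1)) <= #|Z| * (K * r.+1))%N.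
  by rewrite big_split /= -big_distrr /= sum_nat_const.
rewrite -sum_nat_const; apply: leq_sum => psi /small; rewrite en.
have -> : (2 * p * N psi + p * (p * r.+1) = p * (2 * N psi + p * r.+1))%N by ring.
have -> : (K * (p * r.+1) = p * (K * r.+1))%N by ring.
by rewrite ltn_pmul2l // addn1 addnS.
Qed.

(** * From a hyperplane section to the whole set *)

Section Extension.
Variables (psi phi : 'cV[F]_n.+2).
Hypothesis psi0 : psi != 0.
Hypothesis section_large :
  (K * p ^ n <= 2 * p * #|[set a in A | app psi a == 0%R]| + p * p ^ n)%N.
Hypothesis phiI : forall a, a \in A -> app psi a = 0 -> app phi a \in I.

Let w := (p ^ n)%N.
Let w0 : (0 < w)%N. Proof. by rewrite expn_gt0 p0. Qed.
Let part k x : {set 'rV[F]_n.+2} := [set a in A | (app psi a, app phi a) == (k, x)].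
Let al k x := #|part k x|.
Let fib k x : {set 'rV[F]_n.+2} := [set a | (app psi a, app phi a) == (k, x)].

(** A point of the section gives [v] with [psi] zero and [phi] in [I], hence nonzero, so the two
    functionals are independent. *)
Let card_fib k x : #|fib k x| = w.
Proof.
have [u u0] := app_neq0 psi0.
have /set0Pn[v] : [set a in A | app psi a == 0%R] != set0.
  rewrite -card_gt0 lt0n; apply/eqP=> e; move: section_large; rewrite e muln0 add0n.
  rewrite leqNgt => /negP[]; rewrite ltn_pmul2r // /K.
  by have : (p <= m * p)%N; [rewrite leq_pmull | lia].
rewrite inE => /andP[vA /eqP v0]; apply: (card_fibre2 _ u0 v0).
by apply: contraTneq (phiI vA v0) => ->; apply: zero_notin_middle.
Qed.

Let disjoint_fib (X Y : {set 'rV[F]_n.+2}) k x : X \subset fib k x -> Y \subset fib k x ->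
  (forall a, a \in X -> a \notin Y) -> (#|X| + #|Y| <= w)%N.
Proof.
move=> sX sY dXY; rewrite -(card_fib k x) -cardsUI.
have -> : X :&: Y = set0.
  by apply/setP=> a; rewrite !inE; apply/negP=> /andP[/dXY /negP].
by rewrite cards0 addn0 subset_leq_card // subUset sX.
Qed.

Let part_sub k x : part k x \subset fib k x.
Proof. by apply/subsetP=> a; rewrite !inE => /andP[]. Qed.

Let partP k x a : reflect [/\ a \in A, app psi a = k & app phi a = x] (a \in part k x).
Proof.
rewrite inE xpair_eqE.
by apply: (iffP and3P) => -[aA /eqP ? /eqP ?]; split=> //; apply/eqP.
Qed.

Let fibP k x a : reflect (app psi a = k /\ app phi a = x) (a \in fib k x).
Proof. by rewrite inE xpair_eqE; apply: (iffP andP) => -[/eqP ? /eqP ?]; split=> //; apply/eqP. Qed.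

Let al_sum k l x y : (0 < al (k + l)%R (x + y)%R)%N -> (al k x + al l y <= w)%N.
Proof.
rewrite card_gt0 => /set0Pn[c /partP[cA ck cx]].
rewrite -[al l y](card_imset _ (@inv_inj _ (fun b => c - b) (fun b => subKr c b))).
apply: (disjoint_fib (part_sub k x)) => [|a /partP[aA _ _]].
  apply/subsetP=> _ /imsetP[b /partP[bA bk bx] ->]; apply/fibP.
  by rewrite !appB ck cx bk bx !addrK.
apply/negP=> /imsetP[b /partP[bA _ _] e]; apply: (sfA aA bA cA).
by rewrite e subrK.
Qed.

Let al_sub k l x y : (0 < al k x)%N -> (al l y + al (k + l)%R (x + y)%R <= w)%N.
Proof.
rewrite card_gt0 => /set0Pn[a /partP[aA ak ax]].
rewrite -[al l y](card_imset _ (addrI a)).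
apply: (disjoint_fib _ (part_sub (k + l) (x + y))) => [|c /imsetP[b /partP[bA _ _] ->]].
  apply/subsetP=> _ /imsetP[b /partP[bA bk bx] ->]; apply/fibP.
  by rewrite !appD ak ax bk bx.
by apply/negP=> /partP[abA _ _]; apply: (sfA aA bA abA).
Qed.

Let total_al k : line_total al k = #|[set a in A | app psi a == k]|.
Proof.
rewrite -(sum_card_fibres _ (app phi)); apply: eq_bigr => x _.
by apply: eq_card => a; rewrite !inE xpair_eqE andbA.
Qed.

Lemma extension : exists c, forall a, a \in A -> app (phi - c *: psi) a \in I.
Proof.
have cI := card_middle natF cF.
have apI := ap_middle cF.
have sfI := middle_sum_free natF cF.
have alw k x : (al k x <= w)%N by rewrite -(card_fib k x) subset_leq_card ?part_sub.
have S0 : supp (al 0) \subset I.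
  apply/subsetP=> x; rewrite inE card_gt0 => /set0Pn[a /partP[aA ak ax]].
  by rewrite -ax phiI.
have big0 : ((2 * m * p + 2) * w <= 2 * p * line_total al 0%R + p * w)%N by rewrite total_al.
have big : ((2 * m * p + 2) * w <= 2 * \sum_k line_total al k + p * w)%N.
  rewrite (eq_bigr (fun k => #|[set a in A | app psi a == k]|)); last by move=> k _; apply: total_al.
  by rewrite sum_card_fibres.
have [c hc] := plane natF cF cI apI sfI w0 alw al_sum al_sub S0 big0 big.
exists c => a aA; rewrite appDr -scaleNr appZr mulNr; apply: hc.
by rewrite card_gt0; apply/set0Pn; exists a; apply/partP.
Qed.

End Extension.
End Hyperplane.

Lemma row_functional n (A : {set 'rV[F]_n}) : sum_free A -> (0 < n)%N ->
  ((2 * m * p + 2) * p ^ n.-1 <= 2 * p * #|A| + p * p ^ n.-1)%N ->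
  exists phi : 'cV[F]_n, forall a, a \in A -> app phi a \in I.
Proof.
have [k] := ubnP n; elim: k n A => // k IHk [//|[|n]] A le_nk sfA _ large.
  pose B : {set F} := [set a 0 0 | a : 'rV[F]_1 in A].
  have inj : injective (fun a : 'rV[F]_1 => a 0 0).
    by move=> a b e; apply/matrixP=> i j; rewrite !ord1.
  have cB : #|B| = #|A| by apply: card_imset.
  have sfB : sum_free B.
    move=> _ _ _ /imsetP[a aA ->] /imsetP[b bA ->] /imsetP[c cA ->] e.
    by apply: (sfA _ _ _ aA bA cA); apply: inj; rewrite mxE.
  (* Integrality raises the bound [m - 1/2 + 1/p] to [m]. *)
  have mB : (m <= #|B|)%N.
    rewrite cB leqNgt; apply/negP=> lt; move: large; rewrite expn0 !muln1.
    have : (2 * p * #|A| <= 2 * p * (m - 1))%N by rewrite leq_mul2l; apply/orP; right; lia.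
    have -> : (2 * p * (m - 1) = 2 * m * p - 2 * p)%N by rewrite mulnBr muln1 mulnAC.
    by have : (2 * p <= 2 * m * p)%N; [rewrite leq_mul2r; apply/orP; right; lia | have := cF; lia].
  have [c hc] := sum_free_dilate natF cF sfB mB.
  exists (const_mx c) => a aA.
  rewrite /app mxE big_ord1 mxE mulrC; apply: hc; apply/imsetP; by exists a.
have [psi psi0 sec] := ex_large_section sfA large.
(* The rows of [B] give coordinates on the kernel of [psi]. Its rank equals [n + 1] only
   propositionally, which the induction on a bound for the dimension accommodates. *)
pose r := \rank (kermx psi); pose B := row_base (kermx psi).
have er : r = n.+1.
  rewrite /r mxrank_ker -mxrank_tr rank_rV trmx_eq0 psi0; lia.
pose A' : {set 'rV[F]_r} := [set x | x *m B \in A].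
have Bfree : row_free B := row_base_free _.
have BV : B *m pinvmx B = 1%:M := mulmxVp Bfree.
have cA' : #|A'| = #|[set a in A | app psi a == 0]|.
  have injB : injective (fun x : 'rV[F]_r => x *m B) := row_free_inj Bfree.
  rewrite -(card_imset _ injB); apply: eq_card => a; rewrite inE app_eq0.
  apply/imsetP/andP=> [[x + ->]|[aA aK]].
    rewrite inE => xA; split=> //; apply/eqP/sub_kermxP.
    by rewrite (submx_trans (submxMl _ _)) // eq_row_base.
  have : (a <= B)%MS by rewrite eq_row_base; apply/sub_kermxP/eqP.
  by case/submxP=> x ex; exists x; rewrite // inE -ex.
have [||||phi' hphi'] := IHk r A'.
- by rewrite er.
- by move=> x y z; rewrite !inE => xA yA zA e; apply: (sfA _ _ _ xA yA zA); rewrite -e mulmxDl.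
- by rewrite er.
- by rewrite cA' er.
(* As [pinvmx B] is a right inverse of [B], this functional restricts to [phi'] on the kernel. *)
have hphi a : a \in A -> app psi a = 0 -> app (pinvmx B *m phi') a \in I.
  move=> aA /eqP; rewrite app_eq0 => aK.
  have : (a <= B)%MS by rewrite eq_row_base; apply/sub_kermxP/eqP.
  case/submxP=> x ex; have xA' : x \in A' by rewrite inE -ex.
  by have := hphi' x xA'; rewrite /app ex mulmxA -[x *m B *m _]mulmxA BV mulmx1.
have [c hc] := extension sfA large psi0 sec hphi.
by exists (pinvmx B *m phi' - c *: psi).
Qed.

End Functionals.

(** * From a functional to the normal form *)

Lemma natF_Fp p (x : 'F_p) : exists n, x = n%:R.
Proof. by exists x; rewrite natr_Zp. Qed.

Lemma normal_of_functional p n (A : {set 'rV['F_p]_n}) (phi : 'cV['F_p]_n) a0 :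
  a0 \in A -> 0 \notin middle 'F_p (mid p) ->
  (forall a, a \in A -> app phi a \in middle 'F_p (mid p)) -> normal_set A.
Proof.
move=> a0A I0 phiI.
have a00 : app phi a0 != 0 by apply: contraNneq I0 => <-; apply: phiI.
pose f := linfun (mulmxr phi : 'rV['F_p]_n -> 'rV['F_p]_1).
have fE a : (a \in lker f) = (app phi a == 0) by rewrite memv_ker lfunE /= app_eq0.
(* The functional takes the value 1 at [w], so [a - w *+ k] lies in its kernel whenever it maps [a]
   to [k]. *)
pose w := (app phi a0)^-1 *: a0.
have w1 : app phi w = 1 by rewrite appZ mulVf.
exists (lker f), w; split; first 2 last.
- move=> a /phiI /imsetP[j _ ej]; exists (mid p + j)%N, (a - w *+ (mid p + j)%N).
  split; first by have := ltn_ord j; lia.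
    by rewrite fE appB -scaler_nat appZ w1 mulr1 ej subrr.
  by rewrite addrC subrK.
- rewrite /codim; have := limg_ker_dim f fullv; rewrite capfv.
  have := dimvS (subvf (f @: fullv)%VS); rewrite dimvf /= /dim /= mul1n => le1 eD.
  have : (0 < \dim (f @: fullv)%VS)%N.
    rewrite lt0n dimv_eq0; apply/eqP=> f0; have := memv_img f (memvf w).
    rewrite f0 memv0 lfunE /= -app_eq0 w1; apply/negP; exact: oner_neq0.
  have key a b c : (b <= 1 -> a + b = c -> 0 < b -> c - a = 1)%N by clear; lia.
  exact: key le1 eD.
by rewrite fE w1 oner_neq0.
Qed.

Theorem theorem1p5 (p : nat) (p_prime : prime p) (p_mod3 : p = 2 %[mod 3])
    (n : nat) (A : {set 'rV['F_p]_n}) (A_sum_free : sum_free A)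
    (A_large : ((mid p)%:R - 1 / 2 + 1 / p%:R) * p%:R ^ (n%:Z - 1)
               <= #|A|%:R :> rat) :
  normal_set A.
Proof.
have p3 : p.+1 = (3 * mid p)%N.
  by rewrite /mid; move: p_mod3; rewrite (divn_eq p 3); lia.
have cF : #|'F_p|.+1 = (3 * mid p)%N by rewrite card_Fp.
have p0 : (0 < p%:R :> rat) by rewrite ltr0n prime_gt0.
have m1 : 1 <= (mid p)%:R :> rat by rewrite ler1n; lia.
have c0 : 0 < (mid p)%:R - 1 / 2 + 1 / p%:R :> rat.
  have : 0 < p%:R^-1 :> rat by rewrite invr_gt0.
  by rewrite div1r; lra.
have /set0Pn[a0 a0A] : A != set0.
  rewrite -card_gt0 -(ltr0n rat); apply: lt_le_trans A_large.
  by rewrite mulr_gt0 // exprz_gt0.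
have sf0 a : a \in A -> a != 0.
  by move=> aA; apply/eqP=> e; apply: (A_sum_free _ _ _ aA aA aA); rewrite e addr0.
(* In dimension 0 the only vector is [0], which no sum-free set contains. *)
have n0 : (0 < n)%N.
  rewrite lt0n; apply/eqP=> n0; have /eqP[] := sf0 _ a0A.
  by apply/matrixP=> i j; have : (j < 0)%N by rewrite -[X in (_ < X)%N]n0.
have large : ((2 * mid p * p + 2) * p ^ n.-1 <= 2 * p * #|A| + p * p ^ n.-1)%N.
  rewrite -(ler_nat rat) !(natrD, natrM, natrX).
  have e : p%:R ^ (n%:Z - 1) = p%:R ^+ n.-1 :> rat.
    by case: (n) n0 => // k _; rewrite intS addrAC subrr add0r.
  rewrite e in A_large; set q := p%:R ^+ n.-1 in A_large *.
  rewrite -subr_ge0 in A_large; rewrite -subr_ge0.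
  have -> : 2 * p%:R * #|A|%:R + p%:R * q - (2 * (mid p)%:R * p%:R + 2) * q =
    2 * p%:R * (#|A|%:R - ((mid p)%:R - 1 / 2 + 1 / p%:R) * q).
    by field; rewrite gt_eqF.
  by rewrite !mulr_ge0 // ltW.
have {}large : ((2 * mid p * #|'F_p| + 2) * #|'F_p| ^ n.-1 <=
    2 * #|'F_p| * #|A| + #|'F_p| * #|'F_p| ^ n.-1)%N by rewrite card_Fp.
have [phi hphi] := row_functional (@natF_Fp p) cF A_sum_free n0 large.
exact: normal_of_functional a0A (zero_notin_middle (@natF_Fp p) cF) hphi.
Qed.
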